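(* Let $\zeta$ be an aperiodic, primitive and bijective substitution of constant length $q\geq 2$ on an alphabet of two letters. Let $\sigma$ be a primitive aperiodic substitution on a finite alphabet such that the substitution subshift $(X_\sigma,T)$ is a topological factor of $(X_\zeta,T)$. Then, for Lebesgue almost every $\omega\in[0,1)$, $$\frac{\chi_\sigma^+(\omega)}{\log(\rho(M_\sigma))}\leq\frac{\chi_\zeta^+}{\log(q)},$$ where $M_\sigma$ is the substitution matrix of $\sigma$, $\rho(M_\sigma)$ is its spectral radius, and $\chi^+$ denotes the top Lyapunov exponent of the spectral cocycle.
   Context: Substitutions. Let $\mathcal{A}$ be a finite alphabet with at least two letters and $\mathcal{A}^+$ the set of finite non-empty words on $\mathcal{A}$. A substitution is a map $\zeta:\mathcal{A}\to\mathcal{A}^+$, extended to words and sequences by concatenation. For a word $w$, $|w|$ is its length and $|w|_a$ the number of occurrences of the letter $a$ in $w$. The substitution matrix is $M_\zeta(a,b)=|\zeta(b)|_a$; $\zeta$ is primitive if some power of $M_\zeta$ has only positive entries. $\zeta$ has constant length $q\geq2$ if $|\zeta(a)|=q$ for all $a\in\mathcal{A}$. A substitution of constant length $q$ is bijective if for every $j\in\{1,\dots,q\}$ the map sending $a\in\mathcal{A}$ to the $j$-th letter of $\zeta(a)$ is a permutation of $\mathcal{A}$. The substitution subshift $X_\zeta$ is the set of $(x_n)_{n\in\mathbb{Z}}\in\mathcal{A}^{\mathbb{Z}}$ such that every finite word $x_i\dots x_{i+k}$ is a subword of $\zeta^n(a)$ for some $a\in\mathcal{A}$, $n\in\mathbb{N}$;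 $T$ is the left shift, $T((x_n)_n)=(x_{n+1})_n$. $\zeta$ is aperiodic if $X_\zeta$ contains no shift-periodic sequence. A subshift $(Y,T)$ is a topological factor of $(X,T)$ if there is a continuous onto map $\pi:X\to Y$ with $\pi\circ T=T\circ\pi$. Spectral cocycle. Write $e(x)=e^{2\pi i x}$, let $\mathcal{A}=\{1,\dots,m\}$ and $\zeta(a)=w_1\dots w_{k_a}$. For $\xi\in\mathbb{T}^m=(\mathbb{R}/\mathbb{Z})^m$ let $\mathscr{C}_\zeta(\xi,1)$ be the $m\times m$ matrix with entries $$\mathscr{C}_\zeta(\xi,1)(a,b)=\sum_{j=1}^{k_a}\delta_{w_j,b}\,e(\xi_{w_1}+\dots+\xi_{w_{j-1}}),$$ where $\delta$ is the Kronecker delta, and let $\mathscr{C}_\zeta(\xi,n)=\mathscr{C}_\zeta((M_\zeta^T)^{n-1}\xi,1)\cdots\mathscr{C}_\zeta(\xi,1)$. With $\vec 1=(1,\dots,1)^T$, the pointwise top Lyapunov exponent is $$\chi_\zeta^+(\omega)=\limsup_{n\to\infty}\frac1n\log\|\mathscr{C}_\zeta(\omega\vec 1,n)\|,\qquad \omega\in[0,1).$$ When $\zeta$ has constant length, $\chi_\zeta^+(\omega)$ is Lebesgue-almost everywhere equal to a constant, denoted $\chi_\zeta^+$. *)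

(* Defs.v *)
From HB Require Import structures.
From mathcomp Require Import all_boot all_order all_algebra.
From mathcomp Require Import all_classical all_reals all_analysis.
From mathcomp Require Import complex.

Set Implicit Arguments.
Unset Strict Implicit.
Unset Printing Implicit Defensive.
Import Order.TTheory GRing.Theory Num.Theory.
Import numFieldNormedType.Exports.
Local Open Scope classical_set_scope.
Local Open Scope ring_scope.

Record substitution (m : nat) := Substitution {
  subst_fun :> 'I_m -> seq 'I_m;
  subst_neq0 : forall a, subst_fun a != [::] }.

Section Combinatorics.
Variables (m : nat) (zeta : substitution m).

Definition subst_word (w : seq 'I_m) : seq 'I_m := flatten (map zeta w).

Definition subst_mx : 'M[nat]_m := \matrix_(a, b) count_mem a (zeta b).

Definition primitive : Prop :=
  exists2 k : nat, (0 < k)%N & forall a b, (0 < (subst_mx ^+ k) a b)%N.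

Definition constant_length (q : nat) : Prop := forall a, size (zeta a) = q.

(* Letters are indexed from 0. The default letter [a] of [nth] is never used
   when [zeta] has constant length [q]. *)
Definition bijective_subst (q : nat) : Prop :=
  constant_length q /\
  forall j, (j < q)%N -> bijective (fun a => nth a (zeta a) j).

End Combinatorics.

Notation biseq m := (prod_topology (fun _ : int => discrete_topology 'I_m)).

Definition shift (m : nat) (x : biseq m) : biseq m := fun n => x (n + 1).

Definition subshift (m : nat) (zeta : substitution m) : set (biseq m) :=
  [set x | forall (i : int) (k : nat), exists (a : 'I_m) (n : nat),
     infix (mkseq (fun j => x (i + j%:Z) : 'I_m) k.+1)
           (iter n (subst_word zeta) [:: a])].

Definition aperiodic (m : nat) (zeta : substitution m) : Prop :=
  forall x, subshift zeta x ->
  forall p, (0 < p)%N -> iter p (@shift m) x <> x.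

(* [f] is total, but only its restriction to [X] matters: continuity is for the
   topology induced on [X]. *)
Definition topological_factor (m l : nat) (X : set (biseq m))
    (Y : set (biseq l)) : Prop :=
  exists f : biseq m -> biseq l,
    [/\ {within X, continuous f}, f @` X = Y
      & forall x, X x -> f (shift x) = shift (f x)].

Section SpectralCocycle.
Variable R : realType.
Local Open Scope complex_scope.

Definition expi (x : R) : R[i] := cos (2 * pi * x) +i* sin (2 * pi * x).

Section Cocycle.
Variables (m : nat) (zeta : substitution m).

(* Points of the torus are given by real representatives; the entries are
   1-periodic in each coordinate of [xi]. *)
Definition spectral_mx (xi : 'cV[R]_m) : 'M[R[i]]_m :=
  \matrix_(a, b) \sum_(0 <= j < size (zeta a))
    (nth a (zeta a) j == b)%:R *
    expi (\sum_(c <- take j (zeta a)) xi c 0).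

Definition subst_mxR : 'M[R]_m := map_mx (fun k : nat => k%:R) (subst_mx zeta).

Fixpoint spectral_cocycle (xi : 'cV[R]_m) (n : nat) : 'M[R[i]]_m :=
  if n is k.+1 then
    spectral_mx ((subst_mxR^T ^+ k) *m xi) *m spectral_cocycle xi k
  else 1%:M.

(* [mx_norm] is the largest modulus of an entry; any other matrix norm gives the
   same limsup. The logarithm is extended by [lne 0 = -oo]. *)
Definition lyapunov (omega : R) : \bar R :=
  limn_esup (fun n : nat =>
    ((n%:R^-1)%:E *
     lne (complex.Re (mx_norm (spectral_cocycle (const_mx omega) n)))%:E)%E).

Definition ae_lyapunov_eq (c : \bar R) : Prop :=
  {ae (@lebesgue_measure R),
    forall omega : R, omega \in `[0, 1[ -> lyapunov omega = c}.

(* The almost sure value of [lyapunov], which exists (and is unique) when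
   [zeta] has constant length. *)
Definition lyapunov_const : \bar R := get ae_lyapunov_eq.

End Cocycle.

Definition spectral_radius (m : nat) (M : 'M[nat]_m) : R :=
  sup [set complex.Re `|z| |
       z in [set z : R[i] | eigenvalue (map_mx (fun k : nat => k%:R) M) z]].

End SpectralCocycle.

Arguments lyapunov {R m} zeta omega.
Arguments lyapunov_const R {m} zeta.
Arguments spectral_radius R {m} M.

(* Main.v *)
Require Import Defs.
From mathcomp Require Import all_boot all_order all_algebra.
From mathcomp Require Import all_classical all_reals all_analysis.
From mathcomp Require Import measurable_realfun.
From mathcomp Require Import complex ring lra zify.

Set Implicit Arguments.
Unset Strict Implicit.
Unset Printing Implicit Defensive.
Import Order.TTheory GRing.Theory Num.Theory.
Import numFieldNormedType.Exports.
Local Open Scope classical_set_scope.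
Local Open Scope ring_scope.

(** The entry (a, b) of the cocycle of sigma at (omega, n) is the exponential sum
    of e(j omega) over the positions j of the letter b in sigma^n(a), so the
    exponent of sigma measures how fast such sums grow along words of X_sigma.
    A factor map is a block code (Curtis, Hedlund, Lyndon), hence these sums are
    exponential sums, over an interval of length |sigma^n(a)|, of a function of a
    bounded window of a point of X_zeta.  Everything therefore follows from the
    estimate [code_sum_le]: for almost every omega, such window sums over an
    interval of length at most q^n are O(B^n) for each B > exp(chi), where chi is
    the almost sure exponent of zeta.  As |sigma^n(a)| = O(r^n) for each r greater
    than the spectral radius rho ([size_subst_iter_le], by Cayley-Hamilton), taking
    q^N close to r^n bounds the exponent of sigma by ln B ln r / ln q, and letting
    B tend to exp(chi) and r to rho gives the theorem.

    For the window sums, encode the two letters as signs.  Bijectivity says that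
    column j of zeta multiplies signs by a constant s_j.  Desubstituting finitely
    many times replaces the window by two adjacent letters x_j, x_(j+1), and a
    function of two signs is a combination of 1, x_j, x_(j+1) and x_j x_(j+1).
    - The sums of x_j satisfy S(n, omega) = p(omega) S(n - 1, q omega) + O(1), with
      p(omega) the sum of s_r e(r omega); they are controlled by the products
      P_k(omega) of the p(q^i omega), i < k ([sgn_sum_le]).
    - The product x_j x_(j+1) is determined by the columns except at the end of a
      block, where it reproduces itself up to sign.  Each desubstitution costs one
      geometric sum, hence a term 1 / |1 - e(q^k omega)| ([sgn_pair_sum_le]).
    By Borel-Cantelli these small denominators are subexponential in k for almost
    every omega ([small_divisors]).  The cocycle of zeta commutes with the exchange
    of the two letters; its eigenvalues are P_n(omega) and the geometric sum of
    length q^n.  So chi bounds the growth of P_n by definition, and chi >= 0 because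
    of the geometric sum.

    Finally chi has to exist: the exponent of zeta at omega does not change when
    omega is translated by q^(-k), outside a countable set, and a measurable set
    invariant under these translations is null or conull ([zero_one_law], by
    Lebesgue density), so the exponent is almost everywhere constant. *)

(** * Exponential growth rates *)

Section Growth.
Variable R : realType.
Implicit Types (u v : nat -> R) (c : R).

Definition growth_rate u : \bar R :=
  limn_esup (fun n : nat => ((n%:R^-1)%:E * lne (u n)%:E)%E).

Lemma le_limn_esup (u : nat -> \bar R) (a : \bar R) :
  (\forall n \near \oo, (u n <= a)%E) -> (limn_esup u <= a)%E.
Proof.
move=> [N _ uN]; rewrite limn_esup_lim; apply: lime_le; first exact: is_cvg_esups.
near=> m; apply: ge_ereal_sup => _ [n /= mn <-]; apply: uN => /=.
by apply: leq_trans mn; near: m; exists N.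
Unshelve. all: by end_near. Qed.

Lemma limn_esup_lt (u : nat -> \bar R) (a : \bar R) :
  (limn_esup u < a)%E -> \forall n \near \oo, (u n < a)%E.
Proof.
rewrite /limn_esup => /ereal_inf_lt[_ [A [N _ NA] <-]] uA.
exists N => // n /= Nn; apply: le_lt_trans uA; apply: ereal_sup_ubound.
by exists n => //; apply: NA.
Qed.

(** Upper bounds on growth rates are applied in this form: it avoids logarithms of
    sequences that may vanish, and multiplicative constants are visibly harmless. *)
Lemma growth_rate_leP u c : (forall n, 0 <= u n) ->
  (growth_rate u <= c%:E)%E <->
  forall B, expR c < B -> exists2 C, 0 < C & forall n, u n <= C * B ^+ n.
Proof.
move=> u0; split.
- move=> uc B cB; have B0 : 0 < B by apply: lt_trans cB; exact: expR_gt0.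
  have : (growth_rate u < (ln B)%:E)%E.
    apply: le_lt_trans uc _; rewrite lte_fin -(expRK c) ltr_ln ?posrE//.
    exact: expR_gt0.
  move=> /limn_esup_lt[N _ uN].
  (* The constant also absorbs the finitely many n before the bound sets in. *)
  exists (1 + \sum_(i < N.+1) u i / B ^+ i).
    rewrite ltr_pwDl// sumr_ge0// => i _.
    by rewrite divr_ge0// exprn_ge0// ltW.
  move=> n; have Bn : 0 < B ^+ n by rewrite exprn_gt0.
  have sge0 k : 0 <= u k / B ^+ k by rewrite divr_ge0// exprn_ge0// ltW.
  case: (ltnP n N.+1) => nN.
    rewrite -ler_pdivrMr//.
    have h : 0 <= \sum_(i < N.+1 | i != Ordinal nN) u i / B ^+ i by rewrite sumr_ge0.
    by rewrite (bigD1 (Ordinal nN))//=; lra.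
  have : u n <= B ^+ n.
    have := u0 n; rewrite le_eqVlt => /orP[/eqP <-|un0]; first exact: ltW.
    have n0 : (0 < n)%N by case: n nN {Bn un0}.
    have := uN n (ltnW nN); rewrite lne_EFin//= -EFinM lte_fin.
    rewrite mulrC ltr_pdivrMr ?ltr0n// => /ltW h.
    by rewrite -ler_ln ?posrE// lnXn// -mulr_natr.
  move=> /le_trans; apply; rewrite ler_peMl ?(ltW Bn)// lerDl sumr_ge0//.
- move=> h; apply/lee_addgt0Pr => e e0.
  have [|C C0 uC] := h (expR (c + e / 2)).
    by rewrite ltr_expR ltrDl divr_gt0.
  apply: le_limn_esup.
  near=> n; have n0 : (0 < n)%N by near: n; exists 1%N.
  have := u0 n; rewrite le_eqVlt => /orP[/eqP <-|un0].
    by rewrite le0_lneNy// gt0_muleNy ?leNye// lte_fin invr_gt0 ltr0n.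
  rewrite lne_EFin// -EFinM -EFinD lee_fin mulrC ler_pdivrMr ?ltr0n//.
  have : ln (u n) <= ln (C * expR (c + e / 2) ^+ n).
    by rewrite ler_ln ?posrE// mulr_gt0// exprn_gt0// expR_gt0.
  move=> /le_trans; apply; rewrite lnM ?posrE ?exprn_gt0 ?expR_gt0//.
  rewrite lnXn ?expR_gt0// expRK -mulr_natr.
  have : ln C <= (e / 2) * n%:R.
    rewrite mulrC -ler_pdivrMr ?divr_gt0//; near: n; exact: nbhs_infty_ger.
  lra.
Unshelve. all: by end_near. Qed.

Lemma growth_rate_le u v : (forall n, 0 <= u n) -> (forall n, 0 <= v n) ->
  (exists K, forall n, u n <= K * v n) -> (growth_rate u <= growth_rate v)%E.
Proof.
move=> u0 v0 [K uv].
suff H c : (growth_rate v <= c%:E -> growth_rate u <= c%:E)%E.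
  case E : (growth_rate v) => [c| |]; last 2 first.
  - by rewrite leey.
  - rewrite leNgt; apply/negP.
    case E' : (growth_rate u) => [c| |]// _.
    + by have := H (c - 1); rewrite E leNye E' lee_fin => /(_ erefl); lra.
    + by have := H 0; rewrite E leNye E' => /(_ erefl).
  by apply: H; rewrite E.
move=> /(growth_rate_leP _ v0) h; apply/(growth_rate_leP _ u0) => B /h[C C0 vC].
exists ((`|K| + 1) * C); first by rewrite mulr_gt0// ltr_wpDl.
move=> n; apply: le_trans (uv n) _; rewrite -mulrA.
apply: le_trans (_ : `|K| * v n <= _).
  by rewrite ler_wpM2r// ler_norm.
by rewrite ler_pM// lerDl.
Qed.

End Growth.

(** * The cocycle as an exponential sum *)

Section Expi.
Variable R : realType.
Implicit Types x y : R.

Lemma expiD x y : expi (x + y) = expi x * expi y.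
Proof.
rewrite /expi mulrDr cosD sinD; apply/eqP; rewrite eq_complex /=.
by apply/andP; split => //; rewrite addrC [X in _ + X]mulrC addrC mulrC.
Qed.

Lemma expi0 : expi (0 : R) = 1.
Proof. by rewrite /expi mulr0 cos0 sin0. Qed.

Lemma norm_expi x : `|expi x| = 1.
Proof. by rewrite normc_def /= cos2Dsin2 sqrtr1. Qed.

Lemma expi_neq0 x : expi x != 0.
Proof. by rewrite -normr_gt0 norm_expi ltr01. Qed.

Lemma expi_nat (n : nat) : expi (n%:R : R) = 1.
Proof.
have e1 : expi (1 : R) = 1.
  by rewrite /expi mulr1 mulrC mulr_natr cos2pi sin2pi.
elim: n => [|n IHn]; first exact: expi0.
by rewrite -natr1 expiD IHn e1 mulr1.
Qed.

Lemma expi_natl (n : nat) x : expi (n%:R * x) = expi x ^+ n.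
Proof.
elim: n => [|n IHn]; first by rewrite mul0r expi0 expr0.
by rewrite -natr1 mulrDl mul1r expiD IHn exprSr.
Qed.

End Expi.

Section CocycleAsExponentialSum.
Variables (R : realType) (m : nat) (sigma : substitution m).
Implicit Types (w : seq 'I_m) (a b c : 'I_m) (omega : R).

Definition subst_iter n w := iter n (subst_word sigma) w.

Lemma subst_word_cat w1 w2 :
  subst_word sigma (w1 ++ w2) = subst_word sigma w1 ++ subst_word sigma w2.
Proof. by rewrite /subst_word map_cat flatten_cat. Qed.

Lemma subst_iter_cat n w1 w2 :
  subst_iter n (w1 ++ w2) = subst_iter n w1 ++ subst_iter n w2.
Proof. by elim: n => //= n ->; rewrite subst_word_cat. Qed.

Lemma subst_iter_nil n : subst_iter n [::] = [::].
Proof. by elim: n => //= n ->. Qed.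

Lemma subst_iterD n k w : subst_iter (n + k) w = subst_iter n (subst_iter k w).
Proof. by rewrite /subst_iter iterD. Qed.

Lemma subst_iterS n a : subst_iter n.+1 [:: a] = subst_iter n (sigma a).
Proof. by rewrite /subst_iter iterSr /subst_word /= cats0. Qed.

Definition letter_sum w b omega : R[i] :=
  \sum_(0 <= j < size w) (nth b w j == b)%:R * expi (j%:R * omega).

Lemma letter_sum_cat w1 w2 b omega : letter_sum (w1 ++ w2) b omega =
  letter_sum w1 b omega + expi ((size w1)%:R * omega) * letter_sum w2 b omega.
Proof.
rewrite /letter_sum size_cat (@big_cat_nat _ _ _ (size w1))//= ?leq_addr//.
congr (_ + _).
  apply: eq_big_nat => j /andP[_ j1]; by rewrite nth_cat j1.
rewrite -{1}[size w1]add0n big_addn addKn mulr_sumr; apply: eq_bigr => j _.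
rewrite nth_cat ltnNge leq_addl /= addnK natrD mulrDl expiD.
by rewrite mulrA [RHS]mulrC.
Qed.

Lemma size_subst_iter n w : size (subst_iter n w) =
  \sum_(c <- w) size (subst_iter n [:: c]).
Proof.
elim: w => [|a w IHw]; first by rewrite big_nil subst_iter_nil.
by rewrite -cat1s subst_iter_cat size_cat IHw big_cons.
Qed.

Lemma sum_count (V : pzSemiRingType) (w : seq 'I_m) (F : 'I_m -> V) :
  \sum_(c <- w) F c = \sum_c (count_mem c w)%:R * F c.
Proof.
elim: w => [|a w IHw].
  by rewrite big_nil big1// => c _; rewrite mul0r.
rewrite big_cons IHw /=.
under [RHS]eq_bigr => c _ do rewrite natrD mulrDl.
rewrite big_split /=; congr (_ + _).
rewrite (bigD1 a)//= eqxx mul1r big1 ?addr0// => c.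
by rewrite eq_sym => /negPf ->; rewrite mul0r.
Qed.

Lemma subst_mxR_iter n omega a :
  ((subst_mxR R sigma)^T ^+ n *m const_mx omega : 'cV_m) a 0 =
  (size (subst_iter n [:: a]))%:R * omega.
Proof.
elim: n a => [|n IHn] a; first by rewrite expr0 -[1]/(1%:M) mul1mx mxE mul1r.
rewrite exprS -mulmxA mxE.
under eq_bigr => c _ do rewrite IHn !mxE.
rewrite subst_iterS size_subst_iter natr_sum mulr_suml.
rewrite sum_count; apply: eq_bigr => c _; by rewrite mulrA.
Qed.

(** The sum over sigma^n(w) splits along the images of the letters of w; the
    offset of each image is the phase that appears in the spectral matrix at the
    point (M^T)^n xi. *)
Lemma subst_word_sum n w b omega : letter_sum (subst_iter n w) b omega =
  \sum_(0 <= j < size w)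
    expi (\sum_(c <- take j w) (size (subst_iter n [:: c]))%:R * omega) *
    letter_sum (subst_iter n [:: nth b w j]) b omega.
Proof.
elim/last_ind: w => [|w a IHw].
  by rewrite subst_iter_nil /letter_sum !big_geq.
rewrite -cats1 subst_iter_cat letter_sum_cat size_cat addn1 big_nat_recr//=.
rewrite nth_cat ltnn subnn /= take_size_cat// IHw; congr (_ + _).
  apply: eq_big_nat => j /andP[_ jw].
  by rewrite nth_cat jw takel_cat// ltnW.
by rewrite -mulr_suml size_subst_iter natr_sum.
Qed.

Lemma spectral_cocycleE n omega a b :
  spectral_cocycle sigma (const_mx omega : 'cV[R]_m) n a b =
  letter_sum (subst_iter n [:: a]) b omega.
Proof.
elim: n a => [|n IHn] a.
  by rewrite /= mxE /letter_sum big_nat1 mul0r expi0 mulr1 /= eq_sym.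
rewrite subst_iterS subst_word_sum [LHS]/= mxE.
under eq_bigr => c _ do rewrite IHn mxE mulr_suml.
rewrite exchange_big; apply: eq_big_nat => j /andP[_ jw] /=.
rewrite (bigD1 (nth b (sigma a) j))//= [X in _ + X]big1 ?addr0; last first.
  by move=> c; rewrite eq_sym (set_nth_default b) // => /negPf ->; rewrite !mul0r.
rewrite (set_nth_default b)// eqxx mul1r; congr (expi _ * _).
by apply: eq_bigr => c _; rewrite subst_mxR_iter.
Qed.

End CocycleAsExponentialSum.

(** * Real-valued moduli *)

Section Modulus.
Variable R : realType.
Implicit Types (x : R) (z w : R[i]).

(** The modulus with values in R rather than in R[i], so that linear arithmetic
    and the total order of the reals apply. *)
Definition cmod z : R := complex.Re `|z|.

Lemma cmodE z : `|z| = (cmod z)%:C%C.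
Proof. by rewrite /cmod normc_def. Qed.

Lemma cmod_ge0 z : 0 <= cmod z.
Proof. by rewrite -ler0c -cmodE. Qed.

Lemma cmodM z w : cmod (z * w) = cmod z * cmod w.
Proof. by apply: (@complexI R); rewrite rmorphM /= -!cmodE normrM. Qed.

Lemma cmodX z n : cmod (z ^+ n) = cmod z ^+ n.
Proof. by apply: (@complexI R); rewrite rmorphXn /= -!cmodE normrX. Qed.

Lemma cmod0 : cmod 0 = 0.
Proof. by rewrite /cmod normr0. Qed.

Lemma cmod1 : cmod 1 = 1.
Proof. by rewrite /cmod normr1. Qed.

Lemma cmodN z : cmod (- z) = cmod z.
Proof. by rewrite /cmod normrN. Qed.

Lemma cmod_eq0 z : (cmod z == 0) = (z == 0).
Proof. by rewrite -[z == 0]normr_eq0 cmodE fmorph_eq0. Qed.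

Lemma cmodV z : cmod z^-1 = (cmod z)^-1.
Proof. by apply: (@complexI R); rewrite fmorphV /= -!cmodE normfV. Qed.

Lemma cmodD z w : cmod (z + w) <= cmod z + cmod w.
Proof. by rewrite -lecR rmorphD /= -!cmodE ler_normD. Qed.

Lemma cmod_sum (I : Type) (r : seq I) (P : pred I) (F : I -> R[i]) :
  cmod (\sum_(i <- r | P i) F i) <= \sum_(i <- r | P i) cmod (F i).
Proof.
elim/big_rec2 : _ => [|i x z _ h]; first by rewrite cmod0.
by apply: le_trans (cmodD _ _) _; rewrite lerD2l.
Qed.

Lemma cmod_expi x : cmod (expi x) = 1.
Proof. by rewrite /cmod norm_expi. Qed.

Lemma cmod_nat (n : nat) : cmod n%:R = n%:R.
Proof. by rewrite /cmod normr_nat raddfMn. Qed.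

Lemma mx_norm_ge m n (A : 'M[R[i]]_(m, n)) i j :
  cmod (A i j) <= complex.Re (mx_norm A).
Proof.
have : `|A i j| <= mx_norm A.
  have h : (`|A i j|%:nng <= \big[Order.max/0%:nng]_k `|A k.1 k.2|%:nng :> {nonneg R[i]}).
    exact: (le_bigmax _ (fun k : 'I_m * 'I_n => `|A k.1 k.2|%:nng) (i, j)).
  by move: h; rewrite -num_le.
by rewrite cmodE lecE /= => /andP[].
Qed.

Lemma mx_norm_le m n (A : 'M[R[i]]_(m, n)) (c : R) : 0 <= c ->
  (forall i j, cmod (A i j) <= c) -> complex.Re (mx_norm A) <= c.
Proof.
move=> c0 Ac; have [/eqP/mx_norm_eq0 ->|] := boolP (mx_norm A == 0).
  by rewrite mx_norm0.
by move=> /mx_norm_neq0 [[i j] ->]; exact: Ac.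
Qed.

Lemma Re_mx_norm_ge0 m n (A : 'M[R[i]]_(m, n)) : 0 <= complex.Re (mx_norm A).
Proof.
have [/eqP ->//|/mx_norm_neq0 [[i j] ->]] := boolP (mx_norm A == 0).
exact: cmod_ge0.
Qed.

End Modulus.

(** * Growth of word lengths and the spectral radius *)

Section LengthGrowth.
Variable R : realType.

(** Induction on the linear factors of a polynomial that annihilates w: with
    w' = (T - z) w, one has T^(n+1) w = z T^n w + T^n w', and a sequence with
    u_(n+1) = z u_n + O(r^n) and |z| < r is O(r^n). *)
Lemma matrix_power_growth m (T : 'M[R[i]]_m.+1) (r : R) (s : seq R[i])
    (w : 'cV[R[i]]_m.+1) :
  (forall z, z \in s -> cmod z < r) ->
  horner_mx T (\prod_(z <- s) ('X - z%:P)) *m w = 0 ->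
  exists2 C, 0 <= C & forall n a, cmod ((T ^+ n *m w) a 0) <= C * r ^+ n.
Proof.
elim: s w => [|z s IHs] w sr.
  rewrite big_nil rmorph1 mul1mx => ->; exists 0 => // n a.
  by rewrite mulmx0 mxE cmod0 mul0r.
rewrite big_cons mulrC rmorphM /= -mulmxA => /IHs[y ys|C C0 wC].
  by apply: sr; rewrite in_cons ys orbT.
have zr : cmod z < r by apply: sr; rewrite mem_head.
have r0 : 0 < r by apply: le_lt_trans zr; exact: cmod_ge0.
(* The constant K solves C + |z| K = r K. *)
set K := C / (r - cmod z).
have K0 : 0 <= K by rewrite divr_ge0// subr_ge0 ltW.
have S0 : 0 <= \sum_a cmod (w a 0) by rewrite sumr_ge0// => b _; exact: cmod_ge0.
exists (K + \sum_a cmod (w a 0)); first exact: addr_ge0.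
elim=> [|n IHn] a.
  rewrite !expr0 mul1mx mulr1 (bigD1 a)//= addrCA lerDl addr_ge0// sumr_ge0//.
  by move=> b _; exact: cmod_ge0.
have -> : T ^+ n.+1 *m w = z *: (T ^+ n *m w) + T ^+ n *m (horner_mx T ('X - z%:P) *m w).
  rewrite rmorphB /= horner_mx_X horner_mx_C mulmxBl mulmxBr exprSr -mulmxA.
  by rewrite mul_scalar_mx -scalemxAr addrC subrK.
rewrite mxE (le_trans (cmodD _ _))//.
rewrite [in X in cmod X + _]mxE cmodM.
apply: le_trans (_ : cmod z * ((K + \sum_a cmod (w a 0)) * r ^+ n) + C * r ^+ n <= _).
  by apply: lerD => //; rewrite ler_wpM2l// cmod_ge0.
rewrite exprS mulrA -mulrDl [leRHS]mulrA ler_wpM2r ?exprn_ge0 ?(ltW r0)//.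
have -> : C = K * (r - cmod z) by rewrite divfK// subr_eq0 gt_eqF.
have : 0 <= (\sum_a cmod (w a 0)) * (r - cmod z) by rewrite mulr_ge0// subr_ge0 ltW.
move: K0 S0 r0 zr; clearbody K; move: (\sum_a _) (cmod z) => S y; clear => *.
lra.
Qed.

Lemma eigenvalue_le_spectral_radius m (M : 'M[nat]_m.+1) (z : R[i]) :
  eigenvalue (map_mx (fun k : nat => k%:R) M) z -> cmod z <= spectral_radius R M.
Proof.
set A := map_mx _ M => Az; apply: sup_upper_bound; last by exists z.
split; first by exists (cmod z); exists z.
have [s As] := closed_field_poly_normal (char_poly A).
have s_root y : root (char_poly A) y -> y \in s.
  rewrite As (monicP (char_poly_monic A)) scale1r root_prod_XsubC//.
exists (\sum_(y <- s) cmod y) => _ [y /= Ay <-].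
have ys : y \in s by apply: s_root; rewrite -eigenvalue_root_char.
rewrite (big_rem y)//= lerDl sumr_ge0// => x _; exact: cmod_ge0.
Qed.

Lemma char_poly_tr m (M : 'M[R[i]]_m) : char_poly M^T = char_poly M.
Proof.
rewrite /char_poly -[RHS]det_tr; congr (\det _).
by rewrite /char_poly_mx linearB /= tr_scalar_mx map_trmx.
Qed.

(** Cayley-Hamilton makes the product of the X - z over the eigenvalues z of the
    transposed substitution matrix kill every vector; the lengths are the
    coordinates of the powers applied to the all-ones vector. *)
Lemma size_subst_iter_le m (sigma : substitution m) (r : R) :
  spectral_radius R (subst_mx sigma) < r ->
  exists2 C, 0 < C &
    forall n a, (size (subst_iter sigma n [:: a]))%:R <= C * r ^+ n.
Proof.
case: m sigma => [|m] sigma rho_r; first by exists 1 => // n [].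
pose A : 'M[R[i]]_m.+1 := map_mx (fun k : nat => k%:R) (subst_mx sigma).
have [s As] := closed_field_poly_normal (char_poly A).
rewrite (monicP (char_poly_monic A)) scale1r in As.
have sr z : z \in s -> cmod z < r.
  move=> zs; apply: le_lt_trans rho_r; apply: eigenvalue_le_spectral_radius.
  by rewrite eigenvalue_root_char As root_prod_XsubC.
have [|C C0 wC] := @matrix_power_growth m A^T r s (const_mx 1) sr.
  by rewrite -As -char_poly_tr Cayley_Hamilton mul0mx.
have r0 : 0 < r.
  have : size s = m.+1 by apply/eqP; rewrite -eqSS -(size_char_poly A) As size_prod_XsubC.
  case: s sr {As wC} => // z s sr _.
  by apply: le_lt_trans (sr z (mem_head _ _)); exact: cmod_ge0.
exists (C + 1) => [|n a]; first by rewrite ltr_wpDl.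
apply: le_trans (_ : C * r ^+ n <= _); last first.
  by rewrite ler_wpM2r ?lerDl// exprn_ge0// ltW.
apply: le_trans (wC n a); rewrite -[leLHS]cmod_nat le_eqVlt; apply/orP; left.
apply/eqP; congr cmod.
have := @subst_mxR_iter R m.+1 sigma n 1 a; rewrite mulr1 => /(congr1 (real_complex R)).
rewrite rmorph_nat => <-.
set N := subst_mxR R sigma.
have -> : A = map_mx (real_complex R) N.
  by apply/matrixP => i j; rewrite !mxE rmorph_nat.
have -> : (const_mx 1 : 'cV[R[i]]_m.+1) = map_mx (real_complex R) (const_mx 1).
  by apply/matrixP => i j; rewrite !mxE.
have -> : (map_mx (real_complex R) N)^T = map_mx (real_complex R) N^T.
  by apply/matrixP => i j; rewrite !mxE.
have -> : map_mx (real_complex R) N^T ^+ n = map_mx (real_complex R) (N^T ^+ n).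
  elim: n => [|n IHn]; first by rewrite !expr0 map_mx1.
  by rewrite !exprS IHn; exact/esym/map_mxM.
by rewrite [in LHS]mxE [RHS]mxE rmorph_sum; apply: eq_bigr => i _; rewrite rmorphM !mxE.
Qed.

Lemma count_subst_iter m (sigma : substitution m) n a b :
  (subst_mx sigma ^+ n) a b = count_mem a (subst_iter sigma n [:: b]).
Proof.
elim: n b => [|n IHn] b; first by rewrite expr0 mxE natn /= addn0 eq_sym.
rewrite exprSr mxE subst_iterS.
have -> (w : seq 'I_m) : count_mem a (subst_iter sigma n w) =
    \sum_(c <- w) count_mem a (subst_iter sigma n [:: c]).
  elim: w => [|c w IHw]; first by rewrite big_nil subst_iter_nil.
  by rewrite -cat1s subst_iter_cat count_cat IHw big_cons.
rewrite [RHS]sum_count; apply: eq_bigr => c _.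
by rewrite mxE natn IHn mulrC.
Qed.

(** Positivity persists for all larger exponents, as no image is empty. *)
Lemma primitiveP m (sigma : substitution m) : primitive sigma ->
  exists2 k, (0 < k)%N & forall n a b, (k <= n)%N -> a \in subst_iter sigma n [:: b].
Proof.
move=> [k k0 sk]; exists k => // n a b kn.
rewrite -has_pred1 has_count -(subnK kn) -count_subst_iter.
elim: (n - k)%N b => [|j IHj] b; first exact: sk.
rewrite addSn count_subst_iter subst_iterS.
have : sigma b != [::] by exact: subst_neq0.
case: (sigma b : seq _) => // c w _.
by rewrite -cat1s subst_iter_cat count_cat addn_gt0 -count_subst_iter IHj.
Qed.

Lemma size_subst_iter_ge m (sigma : substitution m) k : (2 <= m)%N ->
  (forall n a b, (k <= n)%N -> a \in subst_iter sigma n [:: b]) ->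
  forall n w, (2 ^ n * size w <= size (subst_iter sigma (n * k) w))%N.
Proof.
move=> m2 sk.
have sm a : (2 <= size (subst_iter sigma k [:: a]))%N.
  apply: leq_trans m2 _; rewrite -{1}(card_ord m).
  apply: leq_trans (card_size _); apply/subset_leq_card/fintype.subsetP => b _.
  exact: sk.
elim=> [|n IHn] w; first by rewrite mul1n.
rewrite mulSn subst_iterD size_subst_iter expnS -mulnA.
apply: leq_trans (leq_mul (leqnn 2) (IHn w)) _.
set v := subst_iter _ (n * k) w; rewrite mulnC -sum1_size big_distrl /=.
by apply: leq_sum => c _; rewrite mul1n.
Qed.

(** Otherwise lengths would be O(r^n) for every r > 1; but they double every k
    steps, which is incompatible with r = 2^(1 / (2 k)). *)
Lemma spectral_radius_gt1 m (sigma : substitution m) : (2 <= m)%N ->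
  primitive sigma -> 1 < spectral_radius R (subst_mx sigma).
Proof.
move=> m2 /primitiveP[k k0 sk]; rewrite ltNge; apply/negP => rho1.
have k0' : 0 < k%:R :> R by rewrite ltr0n.
have ln2 : 0 < ln 2 :> R by rewrite ln_gt0// ltr1n.
have [|C C0 sC] := @size_subst_iter_le m sigma (expR (ln 2 / 2 / k%:R)).
  by apply: le_lt_trans rho1 _; rewrite expR_gt1 !divr_gt0.
have s2 := size_subst_iter_ge m2 sk.
pose a : 'I_m := Ordinal (ltnW m2).
have h n : expR (n%:R * (ln 2 / 2)) <= C.
  have /le_trans/(_ (sC (n * k)%N a)) : (2 ^ n)%:R <= (size (subst_iter sigma (n * k) [:: a]))%:R :> R.
    by rewrite ler_nat; have := s2 n [:: a]; rewrite muln1.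
  have -> : expR (ln 2 / 2 / k%:R) ^+ (n * k) = expR (n%:R * (ln 2 / 2)) :> R.
    by rewrite -expRM_natl natrM; congr expR; field; rewrite gt_eqF.
  have -> : (2 ^ n)%:R = expR (n%:R * ln 2) :> R by rewrite expRM_natl lnK ?posrE// natrX.
  rewrite -ler_pdivrMr ?expR_gt0// -expRN -expRD; apply: le_trans.
  by rewrite ler_expR; lra.
have [n nC] : exists n : nat, C < n%:R * (ln 2 / 2).
  exists (Num.truncn (C / (ln 2 / 2))).+1.
  by rewrite -ltr_pdivrMr ?divr_gt0// truncnS_gt.
have := h n; apply/negP; rewrite -ltNge; apply: lt_trans nC _.
by apply: lt_le_trans (expR_ge1Dx _); rewrite ltrDr.
Qed.

End LengthGrowth.

(** * Words occurring in the subshift *)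

Section WordsOfSubshift.
Variables (m : nat) (sigma : substitution m).
Hypotheses (m2 : (2 <= m)%N) (sigma_prim : primitive sigma).

Lemma mem_split (T : eqType) (x : T) (w : seq T) :
  x \in w -> exists u v, w = u ++ x :: v.
Proof. by case/path.splitPr => u v; exists u, v. Qed.

(** An occurrence with letters on both sides makes the nested words
    sigma^(tK)(c) grow in both directions. *)
Lemma interior_self_occurrence (c : 'I_m) : exists K p s,
  [/\ (0 < K)%N, subst_iter sigma K [:: c] = p ++ c :: s, p != [::] & s != [::]].
Proof.
have [k k0 sk] := primitiveP sigma_prim.
have := size_subst_iter_ge m2 sk 2 [:: c]; rewrite muln1.
case E : (subst_iter sigma _ _) => [|x [|y w]]//.
case/lastP: w E => // w z E _.
have [p [s ps]] : exists p s, subst_iter sigma k [:: y] = p ++ c :: s.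
  exact/mem_split/sk.
have nil a : subst_iter sigma k [:: a] != [::].
  by have := sk k c a (leqnn _); case: (subst_iter _ _ _).
exists (k + 2 * k)%N, (subst_iter sigma k [:: x] ++ p),
  (s ++ subst_iter sigma k (rcons w z)); split.
- by rewrite addn_gt0 k0.
- rewrite subst_iterD E -cat1s subst_iter_cat -[y :: _]cat1s subst_iter_cat ps.
  by rewrite -!catA.
- by move: (nil x); case: (subst_iter _ _ _).
- rewrite -cats1 subst_iter_cat; move: (nil z).
  by rewrite -!size_eq0 !size_cat !addn_eq0 => /negPf ->; rewrite !andbF.
Qed.

Lemma size_subst_iter_gt0 n w : w != [::] -> (0 < size (subst_iter sigma n w))%N.
Proof.
elim: n => [|n IHn]; first by case: w.
move=> /IHn; rewrite -[n.+1]add1n subst_iterD.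
case: (subst_iter _ n w) => // a v _; rewrite /subst_iter /= /subst_word /=.
by rewrite size_cat addn_gt0 lt0n size_eq0 subst_neq0.
Qed.

(** The point y is the limit of the words W t = sigma^(tK)(a), each placed inside
    the next one by an interior occurrence of a in sigma^K(a); off t is the
    position of the original letter in W t.  By primitivity sigma^n(a) occurs in
    some W t. *)
Lemma subst_iter_in_subshift (n : nat) (a : 'I_m) :
  exists2 y, subshift sigma y & exists i : int,
    forall j, (j < size (subst_iter sigma n [:: a]))%N ->
      y (i + j%:Z) = nth a (subst_iter sigma n [:: a]) j.
Proof.
have [K [p [s [K0 Ea p0 s0]]]] := interior_self_occurrence a.
pose W t := subst_iter sigma (t * K) [:: a].
pose L t := size (subst_iter sigma (t * K) p).
pose off t := (\sum_(i < t) L i)%N.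
have WS t : W t.+1 =
    subst_iter sigma (t * K) p ++ W t ++ subst_iter sigma (t * K) s.
  by rewrite /W mulSn addnC subst_iterD Ea -subst_iter_cat /= -!subst_iter_cat.
have offS t : off t.+1 = (off t + L t)%N by rewrite /off big_ord_recr.
have off_mono t u : (t <= u)%N -> (off t <= off u)%N.
  by move=> /subnKC <-; rewrite /off big_split_ord /= leq_addr.
have off_ge t : (t <= off t)%N.
  elim: t => // t IHt; rewrite offS -addn1 leq_add//.
  exact: size_subst_iter_gt0.
have W_ge t : (off t + t < size (W t))%N.
  elim: t => [|t IHt]; first by rewrite /off big_ord0.
  have := size_subst_iter_gt0 (t * K) s0.
  by rewrite WS !size_cat offS -/(L t); lia.
have WE t u j : (t <= u)%N -> (j < size (W t))%N ->
    nth a (W u) (off u - off t + j) = nth a (W t) j.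
  move=> /subnKC <-; elim: (u - t)%N => [|d IHd] jt.
    by rewrite addn0 subnn.
  have offd : (off t <= off (t + d))%N.
    exact/off_mono/leq_addr.
  have jd : (off (t + d) - off t + j < size (W (t + d)))%N.
    elim: (d) => [|e IHe]; first by rewrite addn0 subnn.
    have offe : (off t <= off (t + e))%N.
      exact/off_mono/leq_addr.
    by rewrite addnS WS offS !size_cat -/(L _); lia.
  rewrite addnS WS offS nth_cat ifF; last by apply/negbTE; rewrite -leqNgt -/(L _); lia.
  rewrite -/(L _) (_ : _ - _ = off (t + d) - off t + j)%N; last by lia.
  by rewrite nth_cat jd IHd.
pose y : biseq m := fun i : int => nth a (W `|i|%N) (absz ((off `|i|%N)%:Z + i)%R).
have yE t i : (`|i| <= t)%N -> y i = nth a (W t) (absz ((off t)%:Z + i)%R).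
  move=> it; rewrite /y; set r := `|i|%N in it *.
  have offr := off_ge r; have offt : (off r <= off t)%N.
    exact: off_mono.
  rewrite -(WE r t)//; last by have := W_ge r; lia.
  by congr nth; lia.
exists y.
- move=> i k; set t := (`|i| + k)%N.
  exists a, (t * K)%N; rewrite -/(subst_iter _ _ _) -/(W t).
  have -> : mkseq (fun j => y (i + j%:Z) : 'I_m) k.+1 =
      take k.+1 (drop (absz ((off t)%:Z + i)%R) (W t)).
    have offt := off_ge t; have Wt := W_ge t.
    apply: (@eq_from_nth _ a); rewrite size_mkseq ?size_takel ?size_drop//; try lia.
    move=> j jk; rewrite nth_mkseq// nth_take// nth_drop (yE t); last by lia.
    by congr nth; lia.
  exact: (infix_trans (infix_take _ _) (infix_drop _ _)).
- have [k k0 sk] := primitiveP sigma_prim.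
  (* tK - n >= k, so that a occurs in sigma^(tK - n)(a). *)
  pose t := (n + k)%N.
  have tK : (n + k <= t * K)%N by rewrite leq_pmulr.
  have [u [v uv]] : exists u v, subst_iter sigma (t * K - n) [:: a] = u ++ a :: v.
    by apply/mem_split/sk; lia.
  have Wt : W t = subst_iter sigma n u ++ subst_iter sigma n [:: a] ++ subst_iter sigma n v.
    by rewrite /W -{1}(subnKC (_ : n <= t * K)%N) ?subst_iterD ?uv -?subst_iter_cat//; lia.
  exists ((size (subst_iter sigma n u))%:Z - (off t)%:Z) => j jn.
  set U := size _; pose T := (t + off t + U + j)%N.
  rewrite (yE T); last by rewrite /T; lia.
  have offT : (off t <= off T)%N.
    by apply: off_mono; rewrite /T; lia.
  have := WE t T (U + j)%N; rewrite Wt nth_cat -/U ifF; last by lia.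
  rewrite addKn nth_cat jn => <-.
  + by congr nth; lia.
  + by rewrite /T; lia.
  + by rewrite !size_cat -/U; lia.
Qed.

End WordsOfSubshift.

(** * Factor maps are block codes *)

Section BlockCode.
Variables (m l : nat).
Implicit Types (x y : biseq m) (X : set (biseq m)).

Definition window x (r : nat) (i : int) : seq 'I_m :=
  mkseq (fun t => x (i - r%:Z + t%:Z) : 'I_m) (r + r).+1.

Local Instance biseq_nbhs_filter x : ProperFilter (nbhs x) := nbhs_pfilter x.

Lemma biseq_coord_nbhs x (i : int) : \forall y \near x, y i = x i.
Proof.
have := @proj_continuous int (fun _ => discrete_topology 'I_m) i x.
by move=> /(_ [set x i]); apply; exact: discrete_set1.
Qed.

Lemma biseq_range_nbhs x (i : int) (n : nat) :
  \forall y \near x, forall j, (j < n)%N -> y (i + j%:Z) = x (i + j%:Z).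
Proof.
elim: n => [|n IHn]; first by apply: filterE => y j; rewrite ltn0.
near=> y => j; rewrite ltnS leq_eqVlt => /orP[/eqP ->|].
  by near: y; exact: biseq_coord_nbhs.
by move: j; near: y.
Unshelve. all: by end_near. Qed.

Lemma window_nbhs x (r : nat) (i : int) :
  \forall y \near x, window y r i = window x r i.
Proof.
near=> y; apply: (@eq_from_nth _ (x 0)); rewrite !size_mkseq// => j jr.
rewrite !nth_mkseq//.
have : forall j, (j < (r + r).+1)%N -> y (i - r%:Z + j%:Z) = x (i - r%:Z + j%:Z).
  by near: y; exact: biseq_range_nbhs.
by apply.
Unshelve. all: by end_near. Qed.

(** Cylinders form a basis of neighbourhoods: otherwise points outside U agreeing
    with x on longer and longer windows would converge to x. *)
Lemma nbhs_window x (U : set (biseq m)) : nbhs x U ->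
  exists r, forall y, window y r 0 = window x r 0 -> U y.
Proof.
move=> xU; apply: contrapT => /forallNP h.
have {}h r : exists y, window y r 0 = window x r 0 /\ ~ U y.
  by have /existsNP[y /not_implyP yU] := h r; exists y.
have [y yh] := choice h.
have ycvg : y @ \oo --> x.
  apply/cvg_sup => i V [W] [[Z] oZ <-] Zx WV.
  apply: (filterS WV); rewrite nbhs_simpl; exists `|i|%N => // n /= ni.
  suff -> : y n i = x i by [].
  have := congr1 (fun s => nth (x i) s (absz (i + n%:Z)%R)) (yh n).1.
  have ni' : (absz (i + n%:Z)%R < (n + n).+1)%N by lia.
  rewrite !nth_mkseq//.
  by have -> : 0 - n%:Z + (absz (i + n%:Z)%R)%:Z = i by lia.
have [n _ /(_ n (leqnn _))/= Uyn] := ycvg _ xU.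
exact: (yh n).2.
Qed.

Lemma compact_biseq X : closed X -> compact X.
Proof.
move=> cX; apply: (subclosed_compact cX) (@subsetT _ X).
have := @tychonoff int (fun _ => discrete_topology 'I_m) (fun _ => setT).
have -> : [set f : forall i : int, discrete_topology 'I_m | forall i, setT (f i)] = setT.
  by apply/seteqP.
by apply => _; apply: finite_compact; exact: finite_finset.
Qed.

Lemma iter_shift (n : nat) x i : iter n (@Defs.shift m) x i = x (i + n%:Z).
Proof.
elim: n i => [|n IHn] i; first by rewrite addr0.
by rewrite iterS /Defs.shift IHn; congr x; lia.
Qed.

End BlockCode.

Section SubshiftDynamics.
Variables (m : nat) (zeta : substitution m).

Lemma closed_subshift : closed (subshift zeta).
Proof.
move=> x clx i k.
have [y [Xy yx]] := clx _ (@biseq_range_nbhs m x i k.+1).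
have [a [n an]] := Xy i k; exists a, n.
suff -> : mkseq (fun j => x (i + j%:Z) : 'I_m) k.+1 = mkseq (fun j => y (i + j%:Z) : 'I_m) k.+1 by [].
apply: (@eq_from_nth _ a); rewrite !size_mkseq// => j jk.
by rewrite !nth_mkseq// yx.
Qed.

Lemma subshift_translate (x : biseq m) (t : int) : subshift zeta x ->
  subshift zeta (fun i => x (i + t)).
Proof.
move=> Xx i k; have [a [n an]] := Xx (i + t) k; exists a, n.
congr (infix _ _) : an; apply: eq_mkseq => j; congr x; lia.
Qed.

End SubshiftDynamics.

(** The theorem of Curtis, Hedlund and Lyndon: by compactness of X the continuity of
    the coordinate 0 of f is uniform, that is, governed by a window of fixed
    radius; commutation with the shift transports this to every coordinate. *)
Lemma topological_factor_block_code m l (zeta : substitution m)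
    (Y : set (biseq l)) : Y !=set0 -> topological_factor (subshift zeta) Y ->
  exists r (g : seq 'I_m -> 'I_l), forall y, Y y -> exists2 x, subshift zeta x &
    forall i, y i = g (window x r i).
Proof.
move=> Y0 [f [fcts fY fshift]]; set X := subshift zeta.
have fX x : X x -> Y (f x) by rewrite -fY => Xx; exists x.
have [x0 Xx0] : X !=set0 by move: Y0; rewrite -fY => -[_ [x Xx _]]; exists x.
have [r rP] : exists r, forall x x', X x -> X x' ->
    window x r 0 = window x' r 0 -> f x 0 = f x' 0.
  have cX : compact X by apply: compact_biseq; exact: closed_subshift.
  have /compact_near_coveringP/near_covering_withinP/(_ _ \oo) := cX.
  move=> /(_ (fun r x => forall x', X x' -> window x r 0 = window x' r 0 -> f x 0 = f x' 0)).
  case=> [x Xx|r _ rP]; last first.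
    by exists r => x x' Xx; apply: (rP r (leqnn r)).
  have /subspace_continuousP/(_ x Xx)/(_ _ (@biseq_coord_nbhs l (f x) 0)) := fcts.
  rewrite nbhs_simpl => /nbhs_window[r rP].
  exists ([set x' : biseq m | window x' r 0 = window x r 0], [set r' | (r <= r')%N]).
    split => /=; first exact: window_nbhs.
    by exists r.
  move=> [x' r'] /= [x'x rr'] Xx' x'' Xx'' wx.
  have fx' : f x' 0 = f x 0 := rP x' x'x Xx'.
  suff /rP/(_ Xx'') : window x'' r 0 = window x r 0 by rewrite /= fx' => /esym.
  rewrite -x'x.
  apply: (@eq_from_nth _ (x 0)); rewrite !size_mkseq// => j jr.
  rewrite !nth_mkseq//.
  have jr' : (j + (r' - r) < (r' + r').+1)%N by lia.
  have := congr1 (fun s => nth (x 0) s (j + (r' - r))%N) wx.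
  rewrite !nth_mkseq//.
  by have -> : 0 - r'%:Z + (j + (r' - r))%N%:Z = 0 - r%:Z + j%:Z by lia.
have [g gP] : exists g : seq 'I_m -> 'I_l, forall w x, X x -> window x r 0 = w -> f x 0 = g w.
  suff : forall w, exists v, forall x, X x -> window x r 0 = w -> f x 0 = v.
    by move=> /choice[g gP]; exists g.
  move=> w; have [[x [Xx xw]]|h] := pselect (exists x, X x /\ window x r 0 = w).
    by exists (f x 0) => x' Xx' x'w; apply: rP => //; rewrite xw.
  by exists (f x0 0) => x Xx xw; exfalso; apply: h; exists x.
have fiter n x : X x -> f (iter n (@Defs.shift m) x) = iter n (@Defs.shift l) (f x).
  move=> Xx; elim: n => //= n <-; apply: fshift.
  have -> : iter n (@Defs.shift m) x = (fun i => x (i + n%:Z)).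
    by apply/funext => i; rewrite iter_shift.
  exact: subshift_translate.
exists r, g => y; rewrite -fY => -[x Xx <-]; exists x => // i.
(* For i < 0, x is a forward translate of xi, and commutation is used there. *)
pose xi : biseq m := fun j => x (j + i).
have Xxi : X xi by exact: subshift_translate.
have <- : f xi 0 = f x i.
  have [n iE] : exists n : nat, i = n%:Z \/ i = - n%:Z.
    by exists `|i|%N; lia.
  case: iE => iE.
    have -> : xi = iter n (@Defs.shift m) x.
      by apply/funext => j; rewrite iter_shift /xi iE.
    by rewrite fiter// iter_shift add0r iE.
  have -> : x = iter n (@Defs.shift m) xi.
    by apply/funext => j; rewrite iter_shift /xi iE addrK.
  by rewrite fiter// iter_shift iE addNr.
rewrite (gP _ _ Xxi erefl); congr g; apply: eq_mkseq => j.
by rewrite /xi; congr x; lia.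
Qed.

(** * Substitutions of constant length on one-sided sequences *)

Section ConstantLength.
Variables (m q : nat) (zeta : substitution m.+1).
Hypotheses (q0 : (0 < q)%N) (zeta_q : constant_length zeta q).

(** The action of zeta on infinite sequences.  Working with the image of n-fold
    inflation, over arbitrary z, gives bounds uniform over all points at once. *)
Definition inflate (z : nat -> 'I_m.+1) : nat -> 'I_m.+1 :=
  fun j => nth ord0 (zeta (z (j %/ q)%N)) (j %% q).

Lemma size_subst_iter_const n w : size (subst_iter zeta n w) = (q ^ n * size w)%N.
Proof.
elim: n w => [|n IHn] w; first by rewrite mul1n.
rewrite -[n.+1]addn1 subst_iterD IHn expnD expn1 -mulnA; congr (_ * _)%N.
rewrite /subst_iter /= /subst_word size_flatten /shape -map_comp.
rewrite (eq_map (g := fun=> q)); last by move=> a; exact: zeta_q.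
by rewrite sumnE big_map big_const_seq count_predT iter_addn_0.
Qed.

Lemma nth_subst_word w j : (j < q * size w)%N ->
  nth ord0 (subst_word zeta w) j = nth ord0 (zeta (nth ord0 w (j %/ q))) (j %% q).
Proof.
elim: w j => [|a w IHw] j; first by rewrite muln0.
rewrite /= mulnS => jq; rewrite /subst_word /= nth_cat zeta_q.
case: ltnP => jq'; first by rewrite divn_small// modn_small.
rewrite -/(subst_word zeta w) IHw ?ltn_subLR//.
have -> : (j %/ q = ((j - q) %/ q).+1)%N.
  by rewrite -{1}(subnK jq') divnDr ?dvdnn// divnn q0 addn1.
by have -> : (j %% q = (j - q) %% q)%N by rewrite -{1}(subnK jq') modnDr.
Qed.

Lemma iter_inflate n z j i : (i < q ^ n)%N ->
  iter n inflate z (q ^ n * j + i)%N = nth ord0 (subst_iter zeta n [:: z j]) i.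
Proof.
elim: n i => [|n IHn] i iq.
  by move: iq; rewrite expn0 ltnS leqn0 => /eqP ->; rewrite mul1n addn0.
have iq' : (i %/ q < q ^ n)%N by rewrite ltn_divLR// mulnC -expnS.
rewrite iterS /inflate -/inflate.
have -> : subst_iter zeta n.+1 [:: z j] = subst_word zeta (subst_iter zeta n [:: z j]) by [].
rewrite nth_subst_word; last by rewrite size_subst_iter_const muln1 -expnS.
rewrite expnS -mulnA mulnC divnMDl// modnMDl IHn//.
Qed.

End ConstantLength.

(** * Oscillating sums and desubstitution *)

Section OscillatingSums.
Variable R : realType.
Implicit Types (h : nat -> R[i]) (omega : R).

Definition trig_poly q h omega : R[i] :=
  \sum_(0 <= r < q) h r * expi (r%:R * omega).

(** The product of the g (q^i omega) for i < k, in the recursive form in which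
    desubstitution produces it: one factor, then the same product at q omega. *)
Fixpoint scaled_product (q : nat) (g : R -> R[i]) k omega : R[i] :=
  if k is k'.+1 then g omega * scaled_product q g k' (q%:R * omega) else 1.

Lemma cmod_sum_le (I : eqType) (s : seq I) (F : I -> R[i]) (K : R) :
  (forall i, cmod (F i) <= K) -> cmod (\sum_(i <- s) F i) <= (size s)%:R * K.
Proof.
move=> FK; apply: le_trans (cmod_sum _ _ _) _.
apply: le_trans (ler_sum _ (fun i _ => FK i)) _.
by rewrite big_const_seq iter_addr_0 count_predT mulr_natl.
Qed.

Lemma cmod_sum_nat_le A B h (K : R) :
  (forall i, cmod (h i) <= K) -> cmod (\sum_(A <= i < B) h i) <= (B - A)%:R * K.
Proof. by move=> hK; have := cmod_sum_le (index_iota A B) hK; rewrite size_iota. Qed.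

Lemma expi_block (Q j r : nat) omega :
  expi ((Q * j + r)%:R * omega) = expi (j%:R * (Q%:R * omega)) * expi (r%:R * omega).
Proof. by rewrite natrD natrM mulrDl expiD; congr (expi _ * _); ring. Qed.

Lemma sum_blocks h Q A B : (A <= B)%N ->
  \sum_(Q * A <= j < Q * B) h j =
  \sum_(A <= j < B) \sum_(0 <= r < Q) h (Q * j + r)%N.
Proof.
move=> AB; rewrite -(subnKC AB); elim: (B - A)%N => [|n IHn].
  by rewrite addn0 !big_geq.
rewrite addnS big_nat_recr ?leq_addr//= -IHn mulnSr.
rewrite (@big_cat_nat _ _ _ (Q * (A + n))) /=; last 2 first.
- by rewrite leq_mul2l leq_addr orbT.
- exact: leq_addr.
congr (_ + _); rewrite -{1}[(Q * (A + n))%N]add0n big_addn addKn.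
by apply: eq_bigr => r _; rewrite addnC.
Qed.

(** An interval is a union of full blocks of length Q and of two incomplete blocks,
    which cost at most Q each. *)
Lemma regroup_blocks h Q A L : (0 < Q)%N -> (forall j, cmod (h j) <= 1) ->
  exists A' L', (Q * L' <= L)%N /\
    cmod (\sum_(A <= j < A + L) h j) <= (2 * Q)%:R +
    cmod (\sum_(A' <= j < A' + L') \sum_(0 <= r < Q) h (Q * j + r)%N).
Proof.
move=> Q0 h1.
pose A' := ((A + Q.-1) %/ Q)%N; pose E := ((A + L) %/ Q)%N.
have A1 : (A <= Q * A')%N.
  by have := divn_eq (A + Q.-1) Q; have := ltn_pmod (A + Q.-1) Q0; rewrite -/A'; lia.
have A2 : (Q * A' <= A + Q.-1)%N by rewrite mulnC leq_divM.
have E1 : (Q * E <= A + L)%N by rewrite mulnC leq_divM.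
have E2 : (A + L < Q * E + Q)%N.
  by have := divn_eq (A + L) Q; have := ltn_pmod (A + L) Q0; rewrite -/E; lia.
have [AE|EA] := leqP A' E; last first.
  exists 0%N, 0%N; split; first by rewrite muln0.
  rewrite [in X in _ + X]big_geq// cmod0 addr0.
  apply: le_trans (cmod_sum_nat_le _ _ h1) _; rewrite mulr1 ler_nat addKn.
  have : (Q * E + Q <= Q * A')%N by rewrite -mulnSr leq_mul2l EA orbT.
  lia.
exists A', (E - A')%N; split.
  by rewrite mulnBr; lia.
have QAE : (Q * A' <= Q * E)%N by rewrite leq_mul2l AE orbT.
rewrite subnKC// -sum_blocks//.
rewrite (@big_cat_nat _ _ _ (Q * A'))//=; last by lia.
rewrite (@big_cat_nat _ _ _ (Q * E) (Q * A'))//=.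
apply: le_trans (cmodD _ _) _; apply: le_trans (lerD (lexx _) (cmodD _ _)) _.
have := cmod_sum_nat_le A (Q * A') h1; have := cmod_sum_nat_le (Q * E) (A + L) h1.
have : (Q * A' - A)%:R <= Q%:R :> R by rewrite ler_nat; lia.
have : (A + L - Q * E)%:R <= Q%:R :> R by rewrite ler_nat; lia.
by rewrite natrM; lra.
Qed.

Lemma geometric_sum_le omega A B : (A <= B)%N -> expi omega != 1 ->
  cmod (\sum_(A <= j < B) expi (j%:R * omega)) <= 2 / cmod (1 - expi omega).
Proof.
move=> AB w1; have d0 : 0 < cmod (1 - expi omega).
  by rewrite lt_def cmod_ge0 andbT cmod_eq0 subr_eq0 eq_sym.
rewrite ler_pdivlMr// -cmodM.
have -> : (\sum_(A <= j < B) expi (j%:R * omega)) * (1 - expi omega) =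
    expi (A%:R * omega) - expi (B%:R * omega).
  rewrite -(subnKC AB); elim: (B - A)%N => [|n IHn].
    by rewrite addn0 big_geq// mul0r subrr.
  rewrite addnS big_nat_recr ?leq_addr//= mulrDl IHn -natr1 mulrDl mul1r expiD.
  ring.
by apply: le_trans (cmodD _ _) _; rewrite cmodN !cmod_expi.
Qed.

End OscillatingSums.

(** * Sums of signs and of products of adjacent signs *)

Section BijectiveTwoLetters.
Variables (R : realType) (q : nat) (zeta : substitution 2).
Hypotheses (q2 : (2 <= q)%N) (zeta_bij : bijective_subst zeta q).
Implicit Types (omega B C : R) (z : nat -> 'I_2) (a b : 'I_2).

Let q0 : (0 < q)%N. Proof. exact: ltnW. Qed.
Let zeta_q : constant_length zeta q. Proof. exact: zeta_bij.1. Qed.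

Definition sgn a : R[i] := (-1) ^+ a.
Definition col_sgn (j : nat) : R[i] := sgn (nth ord0 (zeta ord0) j).

Lemma cmod_sgn a : cmod (sgn a) = 1.
Proof. by rewrite /sgn cmodX cmodN cmod1 expr1n. Qed.

Lemma sgn_sqr a : sgn a * sgn a = 1.
Proof. by rewrite /sgn -expr2 sqrr_sign. Qed.

Lemma ord2 a : a = ord0 \/ a = ord_max.
Proof. by case: a => -[|[|//]] a2; [left|right]; exact: val_inj. Qed.

Lemma sgn0 : sgn ord0 = 1. Proof. by []. Qed.
Lemma sgn1 : sgn ord_max = -1. Proof. by rewrite /sgn expr1. Qed.

(** A permutation of two letters is the identity or the exchange. *)
Lemma sgn_column j a : (j < q)%N ->
  sgn (nth ord0 (zeta a) j) = col_sgn j * sgn a.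
Proof.
move=> jq; have [->|->] := ord2 a; first by rewrite sgn0 mulr1.
have /bij_inj inj := zeta_bij.2 j jq.
have : nth ord0 (zeta ord0) j != nth ord0 (zeta ord_max) j.
  rewrite (set_nth_default ord_max (s := zeta ord_max)) ?zeta_q//.
  by apply/eqP => /inj.
rewrite /col_sgn; have [->|->] := ord2 (nth ord0 (zeta ord0) j);
  have [->|->] := ord2 (nth ord0 (zeta ord_max) j) ; rewrite ?eqxx// => _; rewrite sgn0 sgn1; ring.
Qed.

Lemma sgn_inflate z j r : (r < q)%N ->
  sgn (inflate q zeta z (q * j + r)%N) = col_sgn r * sgn (z j).
Proof.
move=> rq; rewrite /inflate [(q * j)%N]mulnC divnMDl// divn_small// addn0.
by rewrite modnMDl modn_small// sgn_column.
Qed.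

Definition sgn_poly : R -> R[i] := trig_poly q col_sgn.

Local Notation sgn_product := (scaled_product q sgn_poly).

(** Grouping into blocks of length q gives S(n, omega) = p(omega) S(n - 1, q omega)
    up to 2 q. *)
Lemma sgn_sum_le n omega z A L : (L <= q ^ n)%N ->
  cmod (\sum_(A <= j < A + L)
          sgn (iter n (inflate q zeta) z j) * expi (j%:R * omega)) <=
  (2 * q)%:R * \sum_(0 <= k < n.+1) cmod (sgn_product k omega).
Proof.
have h1 n' omega' j : cmod (sgn (iter n' (inflate q zeta) z j) * expi (j%:R * omega')) <= 1.
  by rewrite cmodM cmod_sgn cmod_expi mulr1.
elim: n omega A L => [|n IHn] omega A L Lq.
  rewrite big_nat1 /= cmod1 mulr1; apply: le_trans (cmod_sum_nat_le _ _ (h1 0%N omega)) _.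
  by rewrite mulr1 ler_nat addKn; apply: leq_trans Lq _; rewrite expn0; lia.
have [A' [L' [LL']]] := regroup_blocks A L q0 (h1 n.+1 omega).
move=> /le_trans; apply; rewrite big_nat_recl// mulrDr /= cmod1 mulr1 lerD2l.
under [X in _ <= _ * X]eq_bigr do rewrite cmodM.
rewrite -mulr_sumr mulrCA.
have Lq' : (L' <= q ^ n)%N by rewrite -(leq_pmul2l q0) -expnS (leq_trans LL').
have := ler_wpM2l (cmod_ge0 (sgn_poly omega)) (IHn (q%:R * omega) A' L' Lq').
apply: le_trans; rewrite -cmodM mulr_sumr le_eqVlt; apply/orP; left; apply/eqP.
congr cmod; apply: eq_bigr => j _; rewrite mulr_suml; apply: eq_big_nat => r /andP[_ rq].
rewrite sgn_inflate// expi_block; ring.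
Qed.

(** Inside a block the product of adjacent signs is the constant s_r s_(r+1), since
    both letters come from the same letter; across the end of a block it is
    s_(q-1) s_0 times the product of the two adjacent letters one level up.  The
    constants contribute a geometric sum at frequency q omega. *)
Lemma sgn_pair_sum_le n omega z A L (K : nat -> R) :
  (forall k, expi (q%:R ^+ k * omega) != 1) ->
  (forall k, (cmod (1 - expi (q%:R ^+ k.+1 * omega)))^-1 <= K k) ->
  (L <= q ^ n)%N ->
  cmod (\sum_(A <= j < A + L)
    sgn (iter n (inflate q zeta) z j) * sgn (iter n (inflate q zeta) z j.+1) *
      expi (j%:R * omega)) <=
  (2 * q)%:R * \sum_(0 <= k < n.+1) (1 + K k).
Proof.
pose x n := iter n (inflate q zeta) z.
have h1 n' omega' j : cmod (sgn (x n' j) * sgn (x n' j.+1) * expi (j%:R * omega')) <= 1.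
  by rewrite !cmodM !cmod_sgn cmod_expi !mulr1.
elim: n omega A L K => [|n IHn] omega A L K w1 wK Lq.
  rewrite big_nat1; apply: le_trans (cmod_sum_nat_le _ _ (h1 0%N omega)) _.
  have K0 : 0 <= K 0%N by apply: le_trans (wK _); rewrite invr_ge0 cmod_ge0.
  rewrite mulr1 addKn; apply: le_trans (_ : 1 <= _).
    by rewrite lern1; rewrite expn0 in Lq.
  rewrite mulrDr mulr1 ler_wpDr// ?mulr_ge0// ler1n; lia.
have [A' [L' [LL']]] := regroup_blocks A L q0 (h1 n.+1 omega).
have Lq' : (L' <= q ^ n)%N by rewrite -(leq_pmul2l q0) -expnS (leq_trans LL').
pose w' := q%:R * omega.
have w'E k : q%:R ^+ k * w' = q%:R ^+ k.+1 * omega by rewrite exprSr mulrA.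
pose c : R[i] := \sum_(0 <= r < q.-1) col_sgn r * col_sgn r.+1 * expi (r%:R * omega).
pose d : R[i] := col_sgn q.-1 * col_sgn 0 * expi ((q.-1)%:R * omega).
have blockE j : \sum_(0 <= r < q) sgn (x n.+1 (q * j + r)%N) *
      sgn (x n.+1 (q * j + r).+1) * expi ((q * j + r)%:R * omega) =
    c * expi (j%:R * w') + d * (sgn (x n j) * sgn (x n j.+1) * expi (j%:R * w')).
  rewrite -{1}(prednK q0) big_nat_recr//=; congr (_ + _).
    rewrite mulr_suml; apply: eq_big_nat => r /andP[_ rq].
    have rq' : (r.+1 < q)%N by rewrite -(prednK q0).
    rewrite -addnS !sgn_inflate//; last exact: ltnW.
    rewrite expi_block -[RHS]mulr1 -(sgn_sqr (iter n (inflate q zeta) z j)); ring.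
  have -> : ((q * j + q.-1).+1 = q * j.+1 + 0)%N by rewrite -addnS prednK// mulnSr addn0.
  by rewrite !sgn_inflate ?prednK// expi_block /d; ring.
under [in X in _ <= _ + X]eq_bigr => j _ do rewrite blockE.
move=> /le_trans; apply; rewrite big_split/=.
rewrite -!mulr_sumr.
apply: le_trans (lerD (lexx _) (cmodD _ _)) _; rewrite !cmodM !cmod_sgn cmod_expi !mul1r.
rewrite big_nat_recl//= mulrDr.
have c_le : cmod c <= q%:R.
  apply: le_trans (cmod_sum_nat_le _ _ (_ : forall r, _ <= 1)) _.
    by move=> r; rewrite !cmodM !cmod_sgn cmod_expi !mulr1.
  by rewrite mulr1 ler_nat subn0 leq_pred.
have e_le : cmod (\sum_(A' <= i < A' + L') expi (i%:R * w')) <= 2 * K 0%N.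
  apply: le_trans (geometric_sum_le (leq_addr _ _) _) _.
    by have := w1 1%N; rewrite expr1.
  by have := wK 0%N; rewrite expr1 => ?; rewrite ler_wpM2l.
have w1' k : expi (q%:R ^+ k * w') != 1 by rewrite w'E.
have wK' k : (cmod (1 - expi (q%:R ^+ k.+1 * w')))^-1 <= K k.+1 by rewrite w'E.
have := IHn w' A' L' (fun k => K k.+1) w1' wK' Lq'.
have K0 : 0 <= K 0%N by apply: le_trans (wK _); rewrite invr_ge0 cmod_ge0.
have := ler_pM (cmod_ge0 _) (cmod_ge0 _) c_le e_le.
rewrite natrM; lra.
Qed.

End BijectiveTwoLetters.

(** * Sums of functions of a window *)

Section CodeSums.
Variables (R : realType) (q : nat) (zeta : substitution 2).
Hypotheses (q2 : (2 <= q)%N) (zeta_bij : bijective_subst zeta q).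
Implicit Types (omega B C : R) (z : nat -> 'I_2) (a b : 'I_2).

Let q0 : (0 < q)%N. Proof. exact: ltnW. Qed.
Let zeta_q : constant_length zeta q. Proof. exact: zeta_bij.1. Qed.

Local Notation sgn_product := (scaled_product q (@sgn_poly R q zeta)).

(** The Diophantine and growth conditions at omega under which all window sums are
    O(B^n).  Non-vanishing is part of it so that the condition passes from omega
    to q omega. *)
Definition tame omega B := exists2 C, 0 <= C & forall k,
  [/\ sgn_product k omega != 0,
      cmod (sgn_product k omega) <= C * B ^+ k,
      expi (q%:R ^+ k * omega) != 1 &
      (cmod (1 - expi (q%:R ^+ k * omega)))^-1 <= C * B ^+ k].

Lemma tame_mul omega B k : 0 < B -> tame omega B -> tame (q%:R ^+ k * omega) B.
Proof.
move=> B0; elim: k omega => [|k IHk] omega; first by rewrite mul1r.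
move=> [C C0 h]; rewrite exprSr -mulrA; apply: IHk.
have p0 : 0 < cmod (@sgn_poly R q zeta omega).
  have [+ _ _ _] := h 1%N; rewrite /= mulr1 => p0.
  by rewrite lt_def cmod_eq0 p0 cmod_ge0.
exists (C * B * (1 + (cmod (@sgn_poly R q zeta omega))^-1)) => [|j].
  by rewrite !mulr_ge0 ?addr_ge0 ?invr_ge0// ltW.
have [h1 h2 h3 h4] := h j.+1; rewrite !mulrA -!exprSr; split => //.
- by apply: contraNneq h1 => /= ->; rewrite mulr0.
- apply: le_trans (_ : C * B / cmod (@sgn_poly R q zeta omega) * B ^+ j <= _).
    by rewrite mulrAC ler_pdivlMr// -mulrA -exprS mulrC -cmodM.
  rewrite ler_wpM2r ?exprn_ge0 ?(ltW B0)// ler_wpM2l ?lerDr//.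
  by rewrite mulr_ge0// ltW.
- apply: le_trans h4 _; rewrite exprS !mulrA [leRHS]mulrAC ler_peMr//.
    by rewrite !mulr_ge0 ?exprn_ge0 ?(ltW B0).
  by rewrite lerDl invr_ge0 ltW.
Qed.

Lemma geometric_sum_bound B n : 1 < B ->
  \sum_(0 <= k < n.+1) B ^+ k <= B / (B - 1) * B ^+ n.
Proof.
move=> B1; have B1' : 0 < B - 1 by rewrite subr_gt0.
rewrite mulrAC ler_pdivlMr// -exprS.
have -> : (\sum_(0 <= k < n.+1) B ^+ k) * (B - 1) = B ^+ n.+1 - 1.
  by rewrite mulrC big_mkord -subrX1.
by rewrite gerBl.
Qed.

(** The constant K such that 2 q times the sum of the (1 + C) B^(k+1), k <= n, is at
    most K B^n. *)
Definition pair_bound B C := (2 * q)%:R * ((1 + C) * B) * (B / (B - 1)).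

Lemma pair_sum_le omega B C (F : 'I_2 -> 'I_2 -> R[i]) : 1 < B -> 0 <= C ->
  (forall a b, cmod (F a b) <= 1) ->
  (forall k, [/\ sgn_product k omega != 0,
      cmod (sgn_product k omega) <= C * B ^+ k,
      expi (q%:R ^+ k * omega) != 1 &
      (cmod (1 - expi (q%:R ^+ k * omega)))^-1 <= C * B ^+ k]) ->
  forall n z A L, (L <= q ^ n)%N ->
  cmod (\sum_(A <= j < A + L)
    F (iter n (inflate q zeta) z j) (iter n (inflate q zeta) z j.+1) *
      expi (j%:R * omega)) <= 4 * (pair_bound B C * B ^+ n).
Proof.
move=> B1 C0 F1 h n z A L Lq.
have B0 : 0 < B by apply: lt_trans B1.
set x := iter n (inflate q zeta) z; set K := pair_bound B C * B ^+ n.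
have qn1 : 1 <= (2 * q)%:R :> R by rewrite ler1n; lia.
have Bn1 : 1 <= B ^+ n by rewrite exprn_ege1// ltW.
have BB : 1 <= B / (B - 1) by rewrite ler_pdivlMr ?subr_gt0// mul1r gerBl.
have sum_le (f : nat -> R) : (forall k, f k <= (1 + C) * B * B ^+ k) ->
    (2 * q)%:R * \sum_(0 <= k < n.+1) f k <= K.
  move=> fk; rewrite /K /pair_bound -[leRHS]mulrA -[leRHS]mulrA ler_wpM2l//.
  apply: le_trans (ler_sum _ (fun k _ => fk k)) _.
  rewrite -mulr_sumr ler_wpM2l ?mulr_ge0 ?addr_ge0 ?(ltW B0)//.
  exact: geometric_sum_bound.
pose S (f : nat -> R[i]) := \sum_(A <= j < A + L) f j * expi (j%:R * omega).
have S0 : cmod (S (fun=> 1)) <= K.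
  have [_ _ e1 e2] := h 0%N; rewrite expr0 mul1r in e1 e2.
  rewrite /S; under eq_bigr do rewrite mul1r.
  apply: le_trans (geometric_sum_le (leq_addr _ _) e1) _.
  apply: le_trans (sum_le (fun k => (1 + C) * B * B ^+ k) (fun k => lexx _)).
  apply: ler_pM => //; rewrite ?invr_ge0 ?cmod_ge0//.
    by rewrite ler_nat; lia.
  apply: le_trans e2 _; rewrite big_nat_recl// expr0 !mulr1.
  have : 0 <= \sum_(0 <= i < n) (1 + C) * B * B ^+ i.+1.
    by apply: sumr_ge0 => i _; rewrite !mulr_ge0 ?addr_ge0 ?exprn_ge0 ?(ltW B0).
  have : (1 + C) * 1 <= (1 + C) * B by rewrite ler_wpM2l ?addr_ge0// ltW.
  lra.
have P_le k : cmod (sgn_product k omega) <= (1 + C) * B * B ^+ k.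
  have [_ hk _ _] := h k; apply: le_trans hk _.
  rewrite -mulrA -exprS; apply: ler_pM; rewrite ?exprn_ge0 ?(ltW B0) ?lerDr//.
  by rewrite ler_eXn2l.
have S1 : cmod (S (fun j => sgn R (x j))) <= K.
  exact: le_trans (sgn_sum_le q2 zeta_bij omega z A Lq) (sum_le _ P_le).
have S2 : cmod (S (fun j => sgn R (x j.+1))) <= K.
  have := sgn_sum_le q2 zeta_bij omega z A.+1 Lq => /le_trans/(_ (sum_le _ P_le)).
  apply: le_trans; rewrite le_eqVlt; apply/orP; left; apply/eqP.
  rewrite addSn big_add1 /= -[LHS]mul1r -{1}(cmod_expi omega) -cmodM mulr_sumr.
  congr cmod; apply: eq_bigr => j _.
  by rewrite -natr1 mulrDl mul1r expiD; ring.
have S3 : cmod (S (fun j => sgn R (x j) * sgn R (x j.+1))) <= K.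
  have w1 k : expi (q%:R ^+ k * omega) != 1 by have [] := h k.
  have wK k : (cmod (1 - expi (q%:R ^+ k.+1 * omega)))^-1 <= C * B ^+ k.+1.
    by have [] := h k.+1.
  have := sgn_pair_sum_le q2 zeta_bij z A w1 wK Lq.
  move=> /le_trans; apply; apply: sum_le => k.
  rewrite mulrDl mulrDl mul1r lerD//; first by rewrite -exprS exprn_ege1// ltW.
  by rewrite exprS mulrA.
(* f e is the Fourier coefficient of F along the character e of {1, -1}^2. *)
pose f (e : 'I_2 -> 'I_2 -> R[i]) : R[i] := (F ord0 ord0 * e ord0 ord0 + F ord0 ord_max * e ord0 ord_max +
  F ord_max ord0 * e ord_max ord0 + F ord_max ord_max * e ord_max ord_max) / 4.
have f_le e : (forall a b, cmod (e a b) <= 1) -> cmod (f e) <= 1.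
  move=> e1; have Fe a b : cmod (F a b * e a b) <= 1.
    by rewrite cmodM -[leRHS]mulr1 ler_pM ?cmod_ge0.
  rewrite /f cmodM cmodV cmod_nat ler_pdivrMr// mul1r.
  apply: le_trans (cmodD _ _) _; apply: le_trans (lerD (cmodD _ _) (lexx _)) _.
  apply: le_trans (lerD (lerD (cmodD _ _) (lexx _)) (lexx _)) _.
  have := Fe ord0 ord0; have := Fe ord0 ord_max; have := Fe ord_max ord0.
  by have := Fe ord_max ord_max; lra.
have FE a b : F a b = f (fun _ _ => 1) + f (fun a' _ => sgn R a') * sgn R a +
    f (fun _ b' => sgn R b') * sgn R b +
    f (fun a' b' => sgn R a' * sgn R b') * (sgn R a * sgn R b).
  by rewrite /f; have [->|->] := ord2 a; have [->|->] := ord2 b;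
    rewrite !sgn0 !sgn1; field.
have -> : \sum_(A <= j < A + L) F (x j) (x j.+1) * expi (j%:R * omega) =
    f (fun _ _ => 1) * S (fun=> 1) + f (fun a' _ => sgn R a') * S (fun j => sgn R (x j)) +
    f (fun _ b' => sgn R b') * S (fun j => sgn R (x j.+1)) +
    f (fun a' b' => sgn R a' * sgn R b') * S (fun j => sgn R (x j) * sgn R (x j.+1)).
  rewrite /S !mulr_sumr -!big_split /=; apply: eq_bigr => j _.
  by rewrite [in LHS]FE; ring.
have fS e s : (forall a b, cmod (e a b) <= 1) -> cmod s <= K -> cmod (f e * s) <= K.
  by move=> /f_le e1 sK; rewrite cmodM -[leRHS]mul1r ler_pM ?cmod_ge0.
apply: le_trans (cmodD _ _) _; apply: le_trans (lerD (cmodD _ _) (lexx _)) _.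
apply: le_trans (lerD (lerD (cmodD _ _) (lexx _)) (lexx _)) _.
have one_le : cmod (1 : R[i]) <= 1 by rewrite cmod1.
have sgn_le a : cmod (sgn R a) <= 1 by rewrite cmod_sgn.
have sgn2_le a b : cmod (sgn R a * sgn R b) <= 1 by rewrite cmodM !cmod_sgn mulr1.
have := fS (fun _ _ => 1) _ (fun _ _ => one_le) S0.
have := fS (fun a' _ => sgn R a') _ (fun a _ => sgn_le a) S1.
have := fS (fun _ b' => sgn R b') _ (fun _ b => sgn_le b) S2.
have := fS (fun a' b' => sgn R a' * sgn R b') _ sgn2_le S3.
lra.
Qed.

(** A window no longer than q^M meets at most two consecutive blocks of level M. *)
Lemma iter_inflate_window M (z : nat -> 'I_2) k (j r : nat) : (k <= q ^ M)%N -> (r < q ^ M)%N ->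
  mkseq (fun t => iter M (inflate q zeta) z (q ^ M * j + r + t)%N) k =
  mkseq (fun t => let i := (r + t)%N in
    if (i < q ^ M)%N then nth ord0 (subst_iter zeta M [:: z j]) i
    else nth ord0 (subst_iter zeta M [:: z j.+1]) (i - q ^ M)) k.
Proof.
move=> kM rM; apply: (@eq_from_nth _ ord0); rewrite !size_mkseq// => t tk.
rewrite !nth_mkseq// -addnA /=; case: ifP => rt; first by rewrite (iter_inflate q0 zeta_q).
move/negbT: rt; rewrite -leqNgt => rt.
have -> : (q ^ M * j + (r + t) = q ^ M * j.+1 + (r + t - q ^ M))%N.
  by rewrite mulnSr -addnA subnKC.
by rewrite (iter_inflate q0 zeta_q)// ltn_subLR//; lia.
Qed.

(** After M desubstitutions with q^M >= k, each residue r modulo q^M contributes a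
    sum of a function of two adjacent letters, at frequency q^M omega. *)
Lemma code_sum_le omega B k (G : seq 'I_2 -> R[i]) : 1 < B -> tame omega B ->
  (forall w, cmod (G w) <= 1) ->
  exists K, forall n z A L, (L <= q ^ n)%N ->
  cmod (\sum_(A <= j < A + L)
    G (mkseq (fun t => iter n (inflate q zeta) z (j + t)%N) k) *
      expi (j%:R * omega)) <= K * B ^+ n.
Proof.
move=> B1 tame_w G1; have B0 : 0 < B by apply: lt_trans B1.
pose M := k; pose Q := (q ^ M)%N.
have kQ : (k <= Q)%N by apply: ltnW; rewrite /Q ltn_expl.
have Q0 : (0 < Q)%N by rewrite expn_gt0 q0.
have [C C0 hC] := tame_mul M B0 tame_w.
pose K' := 4 * pair_bound B C.
have K'0 : 0 <= K'.
  by rewrite /K' /pair_bound !mulr_ge0 ?addr_ge0 ?invr_ge0 ?subr_ge0 ?(ltW B0) ?(ltW B1).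
exists ((2 * Q)%:R + Q%:R * K') => n z A L Lq.
have h1 j : cmod (G (mkseq (fun t => iter n (inflate q zeta) z (j + t)%N) k) *
      expi (j%:R * omega)) <= 1 by rewrite cmodM cmod_expi mulr1.
have Bn j : 1 <= B ^+ j by rewrite exprn_ege1// ltW.
have [nM|Mn] := ltnP n M.
  apply: le_trans (cmod_sum_nat_le _ _ h1) _; rewrite mulr1 addKn.
  apply: le_trans (_ : (2 * Q)%:R <= _).
    rewrite ler_nat; apply: leq_trans Lq _; rewrite mulSn.
    by apply: leq_trans (leq_addr _ _); rewrite leq_pexp2l// ltnW.
  rewrite -[leLHS]mulr1 ler_pM// lerDl mulr_ge0//.
have [A' [L' [LL' /le_trans]]] := regroup_blocks A L Q0 h1; apply.
pose n' := (n - M)%N; pose x := iter n' (inflate q zeta) z.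
have nE : n = (M + n')%N by rewrite subnKC.
have Lq' : (L' <= q ^ n')%N.
  by rewrite -(leq_pmul2l Q0) -expnD -nE (leq_trans LL').
pose F r a b := G (mkseq (fun t => let i := (r + t)%N in
    if (i < q ^ M)%N then nth ord0 (subst_iter zeta M [:: a]) i
    else nth ord0 (subst_iter zeta M [:: b]) (i - q ^ M)) k).
rewrite exchange_big_nat /=.
have F_le r : cmod (\sum_(A' <= j < A' + L') F r (x j) (x j.+1) *
    expi (j%:R * (q%:R ^+ M * omega))) <= K' * B ^+ n'.
  rewrite -mulrA; apply: (pair_sum_le B1 C0 _ hC) => //.
  by move=> a b; exact: G1.
apply: le_trans (_ : (2 * Q)%:R + Q%:R * (K' * B ^+ n') <= _); last first.
  rewrite mulrDl -mulrA lerD//; first by rewrite -[leLHS]mulr1 ler_wpM2l.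
  rewrite ler_wpM2l// ler_wpM2l// ler_weXn2l ?(ltW B1)// leq_subr//.
rewrite lerD2l.
apply: le_trans (_ : cmod (\sum_(0 <= r < Q) expi (r%:R * omega) *
   \sum_(A' <= j < A' + L') F r (x j) (x j.+1) * expi (j%:R * (q%:R ^+ M * omega))) <= _).
  rewrite le_eqVlt; apply/orP; left; apply/eqP; congr cmod.
  apply: eq_big_nat => r /andP[_ rQ]; rewrite mulr_sumr; apply: eq_bigr => j _.
  rewrite expi_block nE iterD iter_inflate_window// -/(F r (x j) (x j.+1)).
  rewrite natrX; ring.
rewrite -[X in X%:R * _]subn0; apply: cmod_sum_nat_le => r.
by rewrite cmodM cmod_expi mul1r.
Qed.

End CodeSums.

(** * A zero-one law for q-adic translations *)

Section ZeroOneLaw.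
Variable R : realType.
Local Notation mu := (@lebesgue_measure R).
Implicit Types (E : set R) (x y r t : R).

Lemma lebesgue_measure_translation E t : measurable E ->
  mu [set x | E (x + t)] = mu E.
Proof.
move=> mE.
have mt : measurable_fun [set: measurableTypeR R] (fun x : R => x + t : measurableTypeR R).
  by apply: measurable_funD => //; exact: measurable_cst.
rewrite [RHS](@lebesgue_measure_unique R (pushforward mu (fun x : R => x + t : measurableTypeR R)))//.
move=> _ [[a b] _ <-]; rewrite /pushforward /=.
rewrite [X in _ = mu X](_ : _ = `]a - t, b - t]%classic); last first.
  by apply/seteqP; split => x /=; rewrite !in_itv /= ltrBlDr lerBrDr.
rewrite !lebesgue_measure_itv /= !lte_fin ltrD2r; case: ifP => // _.
by rewrite -!EFinD; congr (_%:E); ring.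
Qed.

Lemma density_point E : measurable E -> mu E != 0%E ->
  exists x, E x /\ exists2 d, 0 < d & forall r, 0 < r -> r < d ->
    ((3 / 2 * r)%:E < mu (E `&` ball x r))%E.
Proof.
move=> mE E0.
have /= := lebesgue_density mE => -[N [mN N0 NE]].
have [x Ex xlim] : exists2 x, E x & (mu (E `&` ball x r) * (mu (ball x r))^-1)%E
   @[r --> 0^'+] --> (\1_E x)%:E.
  apply: contrapT => h; move/negP: E0; apply; apply/eqP.
  apply/negligibleP => //; exists N; split=> // x Ex; apply: NE => /= xlim.
  by apply: h; exists x.
exists x; split => //; move: xlim.
rewrite indicE mem_set//= => /fine_cvgP[fin /cvgr_gt/(_ (3 / 4))].
move=> /(_ _)[|d /= d0 hd]; first lra.
case: fin => d' /= d'0 hd'; exists (Num.min d d'); first by rewrite lt_min d0.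
move=> r r0; rewrite lt_min => /andP[rd rd'].
have := hd r; rewrite /= sub0r normrN gtr0_norm// => /(_ rd r0).
have := hd' r; rewrite /= sub0r normrN gtr0_norm// => /(_ rd' r0).
rewrite lebesgue_measure_ball ?ltW// inver mulrn_eq0 /= gt_eqF//.
have : (mu (E `&` ball x r) <= (r *+ 2)%:E)%E.
  rewrite -(lebesgue_measure_ball x (ltW r0)) le_measure ?inE//.
    by apply: measurableI => //; exact: measurable_ball.
  exact: measurable_ball.
have : (0 <= mu (E `&` ball x r))%E by exact: measure_ge0.
case: (mu (E `&` ball x r)) => // s s0 s2 _ /=.
rewrite ltr_pdivlMr ?mulrn_wgt0// lte_fin -mulr_natr => h.
lra.
Qed.

(** Were both E and its complement of positive measure, take density points x of E
    and y of the complement.  A q-adic translation moves x within r / 4 of y, and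
    carries E to itself: then E and its complement would each fill more than
    half of the ball of radius r + r / 4 around y. *)
Lemma zero_one_law (q : nat) E : (2 <= q)%N -> measurable E ->
  (forall k x, E (x + (q%:R ^+ k)^-1) <-> E x) ->
  mu E = 0%E \/ mu (~` E) = 0%E.
Proof.
move=> q2 mE Einv.
have [|E0] := eqVneq (mu E) 0%E; first by left.
have [|CE0] := eqVneq (mu (~` E)) 0%E; first by right.
exfalso; move: E0 CE0 => /(density_point mE)[x [Ex [d1 d10 h1]]].
move=> /(density_point (measurableC mE))[y [Ey [d2 d20 h2]]].
have Einvn k n u : E (u + n%:R * (q%:R ^+ k)^-1) <-> E u.
  elim: n => [|n IHn]; first by rewrite mul0r addr0.
  by rewrite -natr1 mulrDl mul1r addrA Einv.
pose r := Num.min d1 d2 / 2.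
have r0 : 0 < r by rewrite divr_gt0// lt_min d10.
have rd1 : r * 2 <= d1 by rewrite divfK// ge_min lexx.
have rd2 : r * 2 <= d2 by rewrite divfK// ge_min lexx orbT.
have q0 : 0 < q%:R :> R by rewrite ltr0n ltnW.
have [k kr] : exists k, (q%:R ^+ k)^-1 <= r / 4 :> R.
  exists (Num.truncn (r / 4)^-1).+1.
  rewrite -[leRHS]invrK lef_pV2 ?posrE ?invr_gt0 ?exprn_gt0// ?(divr_gt0 r0)//.
  apply: le_trans (ltW (truncnS_gt _)) _; rewrite -natrX ler_nat.
  by rewrite ltnW// ltn_expl.
pose s : R := (q%:R ^+ k)^-1.
have {}kr : s <= r / 4 by exact: kr.
have s0 : 0 < s by rewrite invr_gt0 exprn_gt0.
have [t [tE xy1 xy2]] : exists t, [/\ forall u, E (u + t) <-> E u,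
    x + t <= y + r / 4 & y - r / 4 <= x + t].
  have [yx|xy] := lerP x y.
  - pose n := Num.truncn ((y - x) / s).
    have /andP[n1 n2] : n%:R <= (y - x) / s < n.+1%:R.
      by apply: truncn_itv; rewrite divr_ge0 ?subr_ge0// ltW.
    exists (n%:R * s); split; first exact: Einvn.
      by move: n1; rewrite ler_pdivlMr//; lra.
    by move: n2; rewrite ltr_pdivrMr// -natr1; lra.
  - pose n := Num.truncn ((x - y) / s).
    have /andP[n1 n2] : n%:R <= (x - y) / s < n.+1%:R.
      by apply: truncn_itv; rewrite divr_ge0 ?subr_ge0// ltW.
    exists (- (n%:R * s)); split.
    + by move=> u; rewrite -(Einvn k n (u - _)) subrK.
    + by move: n2; rewrite ltr_pdivrMr// -natr1; lra.
    + by move: n1; rewrite ler_pdivlMr//; lra.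
pose r' := r + r / 4.
have r'0 : 0 < r' by rewrite addr_gt0// divr_gt0.
have mb u v : measurable (ball u v : set R) by exact: measurable_ball.
have hx : ((3 / 2 * r)%:E < mu (E `&` ball y r'))%E.
  apply: lt_le_trans (h1 r r0 _) _; first lra.
  rewrite -(lebesgue_measure_translation (- t)); last by apply: measurableI.
  apply: le_measure; rewrite ?inE.
  - rewrite -[X in measurable X]setTI.
    have mt : measurable_fun [set: R] (fun u : R => u - t).
      by apply: measurable_funD => //; exact: measurable_cst.
    by apply: (mt measurableT (E `&` ball x r)); by apply: measurableI.
  - by apply: measurableI => //; exact: measurable_ball.
  - move=> u /= [Eu]; rewrite /ball /= => xu.
    split; first by rewrite -(subrK t u) tE.
    by move: xu; rewrite /r' !ltr_norml; lra.
have hy : ((3 / 2 * r')%:E < mu (~` E `&` ball y r'))%E by apply: h2 => //; rewrite /r'; lra.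
have : (mu (E `&` ball y r') + mu (~` E `&` ball y r') = (r' *+ 2)%:E)%E.
  rewrite -(lebesgue_measure_ball y (ltW r'0)) -measureU.
  - by rewrite -setIUl setUv setTI.
  - by apply: measurableI => //; exact: measurable_ball.
  - by apply: measurableI; [exact: measurableC|exact: measurable_ball].
  - by rewrite setIACA setICr set0I.
move: hx hy; case: (mu (E `&` ball y r')) => [a| |]//; case: (mu (~` E `&` ball y r')) => [b| |]//.
rewrite !lte_fin => ha hb; rewrite -[(_ + _)%E]/((a + b)%:E) => -[].
rewrite -mulr_natr /r'; rewrite /r' in hb; lra.
Qed.

End ZeroOneLaw.

(** * Small divisors *)

Section SmallDivisors.
Variable R : realType.
Implicit Types (omega x y B : R).

Lemma cos_ge_half x : 0 <= x -> x <= pi / 4 -> 1 / 2 <= cos x.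
Proof.
move=> x0 xpi; have pi0 := pi_gt0 R.
have c0 : 0 <= cos x by apply: cos_ge0_pihalf; lra.
have : 0 <= cos (x *+ 2) by apply: cos_ge0_pihalf; rewrite -mulr_natr; lra.
by rewrite cos_mulr2n => c2; rewrite leNgt; apply/negP => c1; nra.
Qed.

(** By the mean value theorem on [0, x / 2], where the cosine is at least 1 / 2, and
    the duplication formula. *)
Lemma sin_ge_linear x : 0 <= x -> x <= pi / 2 -> x / 4 <= sin x.
Proof.
move=> x0 xpi; have pi0 := pi_gt0 R.
have [->|xn0] := eqVneq x 0; first by rewrite mul0r sin0.
have x20 : 0 < x / 2 by rewrite divr_gt0// lt_def xn0.
have [c /andP[c0 cx] sE] : exists2 c, 0 < c < x / 2 & sin (x / 2) = cos c * (x / 2).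
  have [|c + sE] := @MVT R sin cos 0 (x / 2) x20 (fun y _ => is_derive_sin y).
    by apply: continuous_subspaceT => y; exact: continuous_sin.
  rewrite in_itv /= => c0; exists c => //.
  by move: sE; rewrite sin0 !subr0.
have cc : 1 / 2 <= cos c by apply: cos_ge_half; lra.
have cx2 : 1 / 2 <= cos (x / 2) by apply: cos_ge_half; lra.
have -> : sin x = (cos (x / 2) * sin (x / 2)) * 2.
  by rewrite mulr_natr -sin_mulr2n -[_ *+ 2]mulr_natr divfK.
rewrite sE.
have : (1 / 2) * (1 / 2) * (x / 2) <= cos (x / 2) * cos c * (x / 2).
  by rewrite ler_wpM2r ?(ltW x20)// ler_pM.
lra.
Qed.

Lemma cmod_oneBexpi x : cmod (1 - expi x) = 2 * `|sin (pi * x)|.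
Proof.
rewrite /cmod normc_def /expi /=.
have -> : 2 * pi * x = (pi * x) *+ 2 by rewrite -[RHS]mulr_natr; ring.
rewrite cos_mulr2n sin_mulr2n; set c := cos _; set s := sin _.
have cs : c ^+ 2 = 1 - s ^+ 2 by exact: cos2sin2.
have -> : (1 - (c ^+ 2 *+ 2 - 1)) ^+ 2 + (0 - (c * s) *+ 2) ^+ 2 = (2 * s) ^+ 2.
  have -> : (0 - (c * s) *+ 2) ^+ 2 = c ^+ 2 * s ^+ 2 * 4 by ring.
  by rewrite cs; ring.
by rewrite sqrtr_sqr normrM ger0_norm.
Qed.

Lemma nearest_int_le x : exists n : int, `|x - n%:~R| <= cmod (1 - expi x).
Proof.
pose n := Num.floor (x + 1 / 2); exists n.
have /andP[n1 n2] : n%:~R <= x + 1 / 2 < (n + 1)%:~R by exact: floor_itv.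
rewrite intrD in n2.
pose y := x - n%:~R.
have -> : expi x = expi y.
  have -> : x = y + n%:~R by rewrite subrK.
  rewrite expiD; suff -> : expi (n%:~R : R) = 1 by rewrite mulr1.
  case: (n) => k; first by rewrite expi_nat.
  by apply: (mulIf (expi_neq0 (k.+1%:R : R))); rewrite -expiD NegzE mulrNz addNr expi0 expi_nat mulr1.
rewrite -/y cmod_oneBexpi.
have pi2 := pi_ge2 R.
have sabs : `|sin (pi * y)| = `|sin (pi * `|y|)|.
  by have [y0|y0] := lerP 0 y; [rewrite (ger0_norm y0)|rewrite (ltr0_norm y0) mulrN sinN normrN].
have y2 : `|y| <= 1 / 2 by rewrite ler_norml /y; lra.
have := normr_ge0 y; rewrite sabs; move: `|y| y2 => u u2 u0.
have := @sin_ge_linear (pi * u); have := ler_norm (sin (pi * u)).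
move=> h1 h2; apply: le_trans (_ : 2 * sin (pi * u) <= _); last by rewrite ler_wpM2l.
have : pi * u <= pi * (1 / 2) by rewrite ler_wpM2l// (le_trans _ pi2).
have : 2 * u <= pi * u by rewrite ler_wpM2r.
by move=> h3 h4; have := h2 _ _; lra.
Qed.

Lemma expi_int_mul_eq1 omega (q k l : nat) : (k <= l)%N ->
  expi (q%:R ^+ k * omega) = 1 -> expi (q%:R ^+ l * omega) = 1.
Proof.
move=> /subnK <- e1; by rewrite exprD -mulrA -natrX expi_natl e1 expr1n.
Qed.

Local Notation mu := (@lebesgue_measure R).

(** Borel-Cantelli: |1 - e(q^k omega)| < B^(-k) forces omega to be within
    B^(-k) / q^k of a fraction l / q^k with 0 <= l <= q^k, a set of measure at most
    4 B^(-k). *)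
Lemma small_divisors (q : nat) B : (2 <= q)%N -> 1 < B ->
  {ae mu, forall omega, omega \in `[0, 1[ -> exists2 C, 0 <= C & forall k,
    expi (q%:R ^+ k * omega) != 1 /\
    (cmod (1 - expi (q%:R ^+ k * omega)))^-1 <= C * B ^+ k}.
Proof.
move=> q2 B1; have B0 : 0 < B by apply: lt_trans B1.
have q0 : (0 < q)%N by exact: ltnW.
pose Q k := (q ^ k)%N; have Q0 k : 0 < (Q k)%:R :> R by rewrite ltr0n expn_gt0 q0.
pose b k (l : nat) : set R := ball (l%:R / (Q k)%:R : R) (B ^- k / (Q k)%:R).
have mb k l : measurable (b k l) by exact: measurable_ball.
pose F k : set R := \big[setU/set0]_(l < (Q k).+1) b k l.
have mF k : measurable (F k).
  by apply: bigsetU_measurable.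
have muF k : (mu (F k) <= (4 * B ^- k)%:E)%E.
  have Bsum : (mu (F k) <= \sum_(l < (Q k).+1) mu (b k l))%E.
    exact: (@Boole_inequality _ _ _ mu (b k) (Q k).+1 (fun i _ => mb k i)).
  apply: le_trans Bsum _.
  have mball (l : nat) : (mu (b k l) <= ((B ^- k / (Q k)%:R) *+ 2)%:E)%E.
    by rewrite /b lebesgue_measure_ball// divr_ge0 ?invr_ge0 ?exprn_ge0 ?(ltW B0).
  apply: le_trans (lee_sum _ (fun (l : 'I_(Q k).+1) _ => mball l)) _.
  rewrite sumEFin lee_fin sumr_const card_ord.
  apply: le_trans (_ : (2 * ((Q k)%:R + 1)) / (Q k)%:R * B ^- k <= _).
    by rewrite le_eqVlt -[_.+1]addn1 -mulr_natr natrD; apply/orP; left; apply/eqP; ring.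
  rewrite ler_wpM2r ?invr_ge0 ?exprn_ge0 ?(ltW B0)// ler_pdivrMr//.
  have : 1 <= (Q k)%:R :> R by rewrite ler1n expn_gt0 q0.
  lra.
have sumF : (\sum_(k <oo) mu (F k) < +oo)%E.
  apply: le_lt_trans (_ : _ <= (4 * (1 - B^-1)^-1)%:E)%E (ltry _).
  apply: lime_le; first exact: is_cvg_nneseries.
  apply: nearW => n; apply: le_trans (lee_sum _ (fun k _ => muF k)) _.
  rewrite sumEFin lee_fin.
  have := @geometric_le_lim R n 4 B^-1.
  rewrite /series /= => h; under eq_bigr do rewrite -exprVn.
  by apply: h => //; rewrite ?invr_gt0// ger0_norm ?invr_ge0 ?ltW// invf_lt1.
have F0 : mu (lim_sup_set F) = 0%E by exact: (@lim_sup_set_cvg0 _ _ R mu F mF sumF).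
exists (lim_sup_set F); split => //.
  by apply: bigcap_measurable => // n _; apply: bigcup_measurable => k _; exact: mF.
move=> omega /= /not_implyP[]; rewrite in_itv /= => /andP[w0 w1] nC n _ /=.
apply: contrapT => nF; apply: nC.
have Fk k : (n <= k)%N -> B ^- k <= cmod (1 - expi (q%:R ^+ k * omega)).
  move=> nk; rewrite leNgt; apply/negP => wk; apply: nF; exists k => //.
  have [z zw] := nearest_int_le (q%:R ^+ k * omega).
  have {zw}wk := le_lt_trans zw wk.
  have Bk1 : B ^- k <= 1 by rewrite invf_le1 ?exprn_gt0// exprn_ege1// ltW.
  rewrite -natrX -/(Q k) in wk.
  have zl : (-1)%:~R < z%:~R :> R.
    have : 0 <= (Q k)%:R * omega by rewrite mulr_ge0// ltW.
    by move: wk; rewrite ltr_norml; lra.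
  have zr : z%:~R < (Q k).+1%:~R :> R.
    have : (Q k)%:R * omega <= (Q k)%:R * 1 by rewrite ler_wpM2l// ltW.
    by move: wk; rewrite ltr_norml -pmulrn -natr1; lra.
  rewrite !ltr_int in zl zr.
  have [l lE] : exists l : 'I_(Q k).+1, z = l%:Z.
    have zQ : (`|z|%N < (Q k).+1)%N by lia.
    by exists (Ordinal zQ) => /=; lia.
  rewrite /F -bigcup_mkord; exists l => //=.
  rewrite /b /ball /= -(ltr_pM2r (Q0 k)) divfK ?gt_eqF//.
  rewrite -[X in _ * X < _](gtr0_norm (Q0 k)) -normrM mulrBl divfK ?gt_eqF//.
  by rewrite distrC mulrC; move: wk; rewrite lE -pmulrn.
(* The finitely many k < n are absorbed in the constant; none of the divisors
   vanishes, since e(q^k omega) = 1 would persist for all larger k. *)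
pose d k := (cmod (1 - expi (q%:R ^+ k * omega)))^-1.
have d0 k : 0 <= d k by rewrite invr_ge0 cmod_ge0.
have ne1 k : expi (q%:R ^+ k * omega) != 1.
  apply/eqP => e1; have e1' := expi_int_mul_eq1 (leq_addl n k) e1.
  have := Fk (n + k)%N (leq_addr _ _); rewrite e1' subrr cmod0.
  by rewrite leNgt invr_gt0 exprn_gt0.
have s0 : 0 <= \sum_(0 <= i < n) d i by apply: sumr_ge0.
exists (1 + \sum_(0 <= i < n) d i); first by rewrite addr_ge0.
move=> k; split; first exact: ne1.
have Bk : 1 <= B ^+ k by rewrite exprn_ege1// ltW.
have [kn|nk] := ltnP k n.
  apply: le_trans (_ : 1 + \sum_(0 <= i < n) d i <= _); last by rewrite ler_peMr ?addr_ge0.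
  rewrite big_mkord (bigD1 (Ordinal kn))//= -/(d k).
  have : 0 <= \sum_(i < n | i != Ordinal kn) d i by apply: sumr_ge0.
  lra.
apply: le_trans (_ : B ^+ k <= _); last first.
  by rewrite ler_peMl ?exprn_ge0 ?(ltW B0)// lerDl.
rewrite invf_ple ?posrE ?exprn_gt0//; first exact: Fk.
by rewrite lt_def cmod_ge0 andbT cmod_eq0 subr_eq0 eq_sym ne1.
Qed.

End SmallDivisors.

(** * Products along the orbit of multiplication by q *)

Section ScaledProducts.
Variables (R : realType) (q : nat).
Implicit Types (g : R -> R[i]) (c : nat -> R[i]) (omega x : R).

Lemma scaled_productD g n k omega : scaled_product q g (k + n) omega =
  scaled_product q g k omega * scaled_product q g n (q%:R ^+ k * omega).
Proof.
elim: k omega => [|k IHk] omega; first by rewrite expr0 !mul1r.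
by rewrite addSn /= IHk exprSr !mulrA.
Qed.

Lemma scaled_product_neq0 g n omega : (forall k, g (q%:R ^+ k * omega) != 0) ->
  scaled_product q g n omega != 0.
Proof.
move=> g0; elim: n => [|n IHn]; first exact: oner_neq0.
by rewrite -addn1 scaled_productD mulf_neq0//= mulr1.
Qed.

Lemma trig_poly_period c n x : trig_poly q c (x + n%:R) = trig_poly q c x.
Proof.
apply: eq_bigr => r _; rewrite mulrDr expiD -natrM expi_nat mulr1 //.
Qed.

Lemma scaled_product_period c k n x :
  scaled_product q (trig_poly q c) k (x + n%:R) = scaled_product q (trig_poly q c) k x.
Proof.
elim: k n x => [//|k IHk] n x /=.
by rewrite trig_poly_period mulrDr -natrM IHk.
Qed.

(** From index k on the products at x and y have the same remaining factors; the
    quotients of the first ones are absorbed in K. *)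
Lemma scaled_product_compare g k x y :
  (forall n, scaled_product q g n y != 0) ->
  (forall n, scaled_product q g n (q%:R ^+ k * x) =
             scaled_product q g n (q%:R ^+ k * y)) ->
  exists K, forall n,
    cmod (scaled_product q g n x) <= K * cmod (scaled_product q g n y).
Proof.
move=> y0 xy; pose f n z := scaled_product q g n z.
have f0 n : 0 < cmod (f n y) by rewrite lt_def cmod_ge0 cmod_eq0 y0.
pose K n := cmod (f n x) / cmod (f n y).
have K0 n : 0 <= K n by rewrite divr_ge0 ?cmod_ge0.
have KS n : (n < k.+1)%N -> K n <= \sum_(i < k.+1) K i.
  by move=> nk; rewrite (bigD1 (Ordinal nk))//= lerDl sumr_ge0.
exists (\sum_(i < k.+1) K i) => n.
have Kf i : K i * cmod (f i y) = cmod (f i x) by rewrite divfK ?gt_eqF.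
have [nk|kn] := ltnP n k.+1.
  by rewrite -/(f n _) -/(f n _) -Kf ler_wpM2r ?cmod_ge0// KS.
rewrite -(subnKC (ltnW kn)) !scaled_productD xy !cmodM mulrA.
rewrite ler_wpM2r ?cmod_ge0//.
by rewrite -/(f k _) -/(f k _) -Kf ler_wpM2r ?cmod_ge0// KS.
Qed.

Lemma block_sum_scaled_product c (a : nat -> nat -> R[i]) n omega : (0 < q)%N ->
  (forall n j r, (r < q)%N -> a n.+1 (q * j + r)%N = c r * a n j) ->
  \sum_(0 <= j < q ^ n) a n j * expi (j%:R * omega) =
  a 0%N 0%N * scaled_product q (trig_poly q c) n omega.
Proof.
move=> q0 aS; elim: n omega => [|n IHn] omega.
  by rewrite expn0 big_nat1 mul0r expi0.
rewrite expnS -[0%N in LHS](muln0 q) sum_blocks//= mulrCA -IHn mulr_sumr.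
apply: eq_bigr => j _; rewrite mulr_suml; apply: eq_big_nat => r /andP[_ rq].
by rewrite aS// expi_block; ring.
Qed.

End ScaledProducts.

(** * The cocycle of a bijective substitution on two letters *)

Section TwoLetterCocycle.
Variables (R : realType) (q : nat) (zeta : substitution 2).
Hypotheses (q2 : (2 <= q)%N) (zeta_bij : bijective_subst zeta q).
Implicit Types (omega : R) (a b : 'I_2).

Let q0 : (0 < q)%N. Proof. exact: ltnW. Qed.
Let zeta_q : constant_length zeta q. Proof. exact: zeta_bij.1. Qed.

Local Notation sgn_product := (scaled_product q (@sgn_poly R q zeta)).
Local Notation geo_product := (scaled_product q (@trig_poly R q (fun=> 1))).

Lemma geo_productE n omega :
  \sum_(0 <= j < q ^ n) expi (j%:R * omega) = geo_product n omega.
Proof.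
rewrite -[RHS]mul1r -(@block_sum_scaled_product R q (fun=> 1) (fun _ _ => 1) n omega q0).
  by apply: eq_bigr => j _; rewrite mul1r.
by move=> *; rewrite mulr1.
Qed.

(** The indicator of b at a sign x is (1 + sgn b x) / 2; this diagonalizes the
    cocycle in the basis of symmetric and antisymmetric vectors. *)
Lemma two_letter_letter_sum n a b omega :
  letter_sum (subst_iter zeta n [:: a]) b omega =
  (geo_product n omega + sgn R a * sgn R b * sgn_product n omega) / 2.
Proof.
rewrite -geo_productE.
have := @block_sum_scaled_product R q (col_sgn R zeta)
  (fun n j => sgn R (iter n (inflate q zeta) (fun=> a) j)) n omega q0.
move=> /(_ (fun n j r => @sgn_inflate R q zeta q2 zeta_bij _ j r)) /= h.
rewrite -mulrA mulrCA -h mulr_sumr -big_split mulr_suml /=.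
rewrite /letter_sum (size_subst_iter_const zeta_q) muln1.
apply: eq_big_nat => j /andP[_ jq].
have -> : nth b (subst_iter zeta n [:: a]) j = iter n (inflate q zeta) (fun=> a) j.
  have := iter_inflate q0 zeta_q (fun=> a) 0 jq; rewrite muln0 => ->.
  by apply: set_nth_default; rewrite (size_subst_iter_const zeta_q) muln1.
set l := iter _ _ _ _; have [->|->] := ord2 l; have [->|->] := ord2 b;
  rewrite ?sgn0 ?sgn1 /=; by field.
Qed.

Definition two_letter_size n omega : R :=
  cmod (geo_product n omega) + cmod (sgn_product n omega).

Lemma lyapunov_two_letter omega :
  lyapunov zeta omega = growth_rate (fun n => two_letter_size n omega).
Proof.
pose N n := complex.Re (mx_norm (spectral_cocycle zeta (const_mx omega : 'cV[R]_2) n)).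
have N0 n : 0 <= N n by exact: Re_mx_norm_ge0.
have u0 n : 0 <= two_letter_size n omega by rewrite addr_ge0 ?cmod_ge0.
have entry n a b : cmod ((geo_product n omega + sgn R a * sgn R b * sgn_product n omega) / 2) <= N n.
  by rewrite -two_letter_letter_sum -spectral_cocycleE; exact: mx_norm_ge.
have c2 : cmod (2 : R[i])^-1 = 2^-1 by rewrite cmodV cmod_nat.
apply/eqP; rewrite eq_le; apply/andP; split; apply: growth_rate_le => //.
- exists 1 => n; rewrite mul1r; apply: mx_norm_le => // a b.
  rewrite spectral_cocycleE two_letter_letter_sum cmodM c2.
  apply: le_trans (_ : cmod (geo_product n omega + sgn R a * sgn R b * sgn_product n omega) <= _).
    by rewrite ler_piMr ?cmod_ge0// invf_le1// ler1n.
  by apply: le_trans (cmodD _ _) _; rewrite !cmodM !cmod_sgn !mul1r.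
- exists 4 => n; rewrite /two_letter_size.
  have e1 := entry n ord0 ord0; have e2 := entry n ord0 ord_max.
  set D := geo_product n omega in e1 e2 *; set P := sgn_product n omega in e1 e2 *.
  rewrite !sgn0 ?sgn1 in e1 e2.
  set X := (_ / 2) in e1; set Y := (_ / 2) in e2.
  have DE : D = X + Y by rewrite /X /Y; field.
  have PE : P = X - Y by rewrite /X /Y; field.
  have := cmodD X Y; have := cmodD X (- Y); rewrite cmodN -DE -PE.
  lra.
Qed.

End TwoLetterCocycle.

(** * The countable exceptional set *)

Section ExceptionalSet.
Variable R : realType.
Implicit Types (x : R) (c : nat -> R[i]).

Lemma expi_eq1 x : expi x = 1 -> exists n : int, x = n%:~R.
Proof.
move=> x1; have [n] := nearest_int_le x; rewrite x1 subrr cmod0 normr_le0.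
by rewrite subr_eq0 => /eqP ->; exists n.
Qed.

Lemma expi_fiber_countable (z : R[i]) : countable [set x : R | expi x = z].
Proof.
have [[x0 x0z]|h] := pselect (exists x0 : R, expi x0 = z); last first.
  suff -> : [set x : R | expi x = z] = set0 by exact: countable0.
  by apply/seteqP; split => // x xz; apply: h; exists x.
apply: (@sub_countable _ _ _ ((fun n : int => x0 + n%:~R) @` [set: int])); last first.
  by apply: sub_countable (card_image_le _ _) _; exact: countableP.
apply: subset_card_le => x /= xz.
have [n nE] : exists n : int, x - x0 = n%:~R.
  by apply: expi_eq1; apply: (mulIf (expi_neq0 x0)); rewrite -expiD subrK mul1r x0z.
by exists n => //; rewrite -nE addrC subrK.
Qed.

Lemma trig_poly_zeros_countable q c : (0 < q)%N -> c 0%N != 0 ->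
  countable [set x : R | trig_poly q c x = 0].
Proof.
move=> q0 c0; pose p := \poly_(r < q) c r.
have p0 : p != 0.
  apply: contraNneq c0 => p0; have : p`_0 = c 0%N by rewrite coef_poly q0.
  by rewrite p0 coef0 => <-.
have pE x : trig_poly q c x = p.[expi x].
  rewrite horner_poly /trig_poly big_mkord; apply: eq_bigr => r _.
  by rewrite expi_natl.
have [s sE] := closed_field_poly_normal p.
apply: (@sub_countable _ _ _ (\bigcup_(z in [set` s]) [set x : R | expi x = z])); last first.
  apply: bigcup_countable; first exact: finite_set_countable.
  by move=> z _; exact: expi_fiber_countable.
apply: subset_card_le => x /=; rewrite pE sE hornerZ => /eqP.
rewrite mulf_eq0 lead_coef_eq0 (negPf p0) /= => xs.
by exists (expi x) => //=; rewrite -root_prod_XsubC.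
Qed.

(** All q-adic translates are included so that the complement is exactly, and not
    just almost everywhere, invariant. *)
Definition exceptional q c : set R :=
  [set x | exists i j (z : int),
    trig_poly q c (q%:R ^+ i * (x + z%:~R * (q%:R ^+ j)^-1)) = 0].

Lemma exceptional_countable q c : (0 < q)%N -> c 0%N != 0 ->
  countable (exceptional q c).
Proof.
move=> q0 c0; have qn0 i : q%:R ^+ i != 0 :> R by rewrite expf_neq0// pnatr_eq0 -lt0n.
pose f (t : nat * nat * int) (y : R) : R :=
  y / q%:R ^+ t.1.1 - t.2%:~R * (q%:R ^+ t.1.2)^-1.
apply: (@sub_countable _ _ _ (\bigcup_(t in [set: nat * nat * int])
   (f t @` [set y : R | trig_poly q c y = 0]))); last first.
  apply: bigcup_countable; first exact: countableP.
  move=> t _; apply: sub_countable (card_image_le _ _) _.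
  exact: trig_poly_zeros_countable.
apply: subset_card_le => x /= [i [j [z xz]]].
exists (i, j, z) => //=; exists (q%:R ^+ i * (x + z%:~R * (q%:R ^+ j)^-1)) => //.
by rewrite /f /= mulrAC mulfV ?mul1r ?addrK.
Qed.

Lemma exceptional_translate q c k x : (0 < q)%N ->
  exceptional q c (x + (q%:R ^+ k)^-1) <-> exceptional q c x.
Proof.
move=> q0; have qn0 i : q%:R ^+ i != 0 :> R by rewrite expf_neq0// pnatr_eq0 -lt0n.
have qE (n : nat) : (q ^ n)%N%:Z%:~R = q%:R ^+ n :> R by rewrite -pmulrn natrX.
split=> -[i [j [z xz]]]; exists i, (j + k)%N.
- exists (z * (q ^ k)%N%:Z + (q ^ j)%N%:Z); rewrite -xz; congr (trig_poly _ _ (_ * _)).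
  rewrite rmorphD rmorphM /= !qE exprD -addrA; congr (_ + _).
  by field; rewrite !qn0.
- exists (z * (q ^ k)%N%:Z - (q ^ j)%N%:Z); rewrite -xz; congr (trig_poly _ _ (_ * _)).
  rewrite rmorphB rmorphM /= !qE exprD -addrA; congr (_ + _).
  by field; rewrite !qn0.
Qed.

Lemma exceptionalN q c x : ~ exceptional q c x ->
  forall k, trig_poly q c (q%:R ^+ k * x) != 0.
Proof.
move=> xe k; apply/eqP => xk; apply: xe; exists k, 0%N, 0.
by rewrite mul0r addr0.
Qed.

End ExceptionalSet.

(** * Functions invariant under q-adic translations *)

Section AlmostSurelyConstant.
Variable R : realType.
Local Notation mu := (@lebesgue_measure R).

(** By the zero-one law every sublevel set of f is null or conull; the constant is
    the infimum of the levels at which it is conull. *)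
Lemma ae_constant (q : nat) (f : R -> \bar R) (Z : set R) (M : R) :
  (2 <= q)%N -> measurable_fun setT f -> countable Z ->
  (forall k x, Z (x + (q%:R ^+ k)^-1) <-> Z x) ->
  (forall k x, ~ Z x -> f (x + (q%:R ^+ k)^-1) = f x) ->
  (forall x, (f x <= M%:E)%E) ->
  {ae mu, forall x, x \in `[0, 1[ -> (0 <= f x)%E} ->
  exists2 chi : R, 0 <= chi & {ae mu, forall x, f x = chi%:E}.
Proof.
move=> q2 mf cZ Zinv finv fM f0.
have mZ : measurable Z by exact: countable_measurable.
have Z0 : mu Z = 0%E by exact: countable_lebesgue_measure0.
pose F (c : R) : set R := [set x | (f x <= c%:E)%E] `&` ~` Z.
have mF c : measurable (F c).
  apply: measurableI; last exact: measurableC.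
  rewrite -[X in measurable X]setTI.
  have -> : [set x | (f x <= c%:E)%E] = f @^-1` `]-oo, c%:E]%classic.
    by apply/seteqP; split => x /=; rewrite in_itv.
  by apply: mf => //; exact: emeasurable_itv.
have Finv c k x : F c (x + (q%:R ^+ k)^-1) <-> F c x.
  rewrite /F /=; split=> -[fx Zx].
    have Zx' : ~ Z x by move=> /(Zinv k).
    by split => //; rewrite -(finv k).
  by split; [rewrite finv|move=> /Zinv].
have mFC c : measurable (~` F c) by apply: measurableC; exact: mF.
have F01 c : mu (F c) = 0%E \/ mu (~` F c) = 0%E by exact: (zero_one_law q2 (mF c) (Finv c)).
pose S : set R := [set c | mu (~` F c) = 0%E].
have SM : S M.
  rewrite /S /= (_ : ~` F M = Z)//; apply/seteqP; split => x; rewrite /F /=.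
    by move=> h; apply: contrapT => Zx; apply: h; split.
  by move=> Zx [].
have S0 : lbound S 0.
  move=> c Sc; rewrite leNgt; apply/negP => c0.
  case: f0 => N [mN N0 fN].
  have : (mu `[0%R, 1%R[%classic <= mu (N `|` ~` F c))%E.
    apply: le_measure; rewrite ?inE//.
      by apply: measurableU => //; exact: mFC.
    move=> x x01; have [Nx|Nx] := pselect (N x); [by left|right => -[fx _]].
    apply: Nx; apply: fN => /= h; have := le_trans (h x01) fx.
    by rewrite lee_fin leNgt c0.
  rewrite lebesgue_measure_itv /= lte_fin ltr01 oppr0 adde0.
  apply/negP; rewrite -ltNge; apply: (@le_lt_trans _ _ 0%E); last by rewrite lte_fin.
  rewrite (_ : mu _ = 0%E)//; apply/negligibleP.
    by apply: measurableU => //; exact: mFC.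
  apply: negligibleU; apply/negligibleP => //.
  exact: mFC.
have infS : has_inf S by split; [exists M|exists 0].
exists (inf S).
  by apply: lb_le_inf => //; exists M.
have up n : mu (~` F (inf S + n.+1%:R^-1)) = 0%E.
  have [|c Sc cS] := @inf_adherent _ S n.+1%:R^-1 _ infS; first by rewrite invr_gt0.
  apply/negligibleP; first exact: mFC.
  exists (~` F c); split => //; first exact: mFC.
  apply: subsetC => x [fx Zx]; split => //=.
  by apply: le_trans fx _; rewrite lee_fin ltW.
have down n : mu (F (inf S - n.+1%:R^-1)) = 0%E.
  have [//|SF] := F01 (inf S - n.+1%:R^-1).
  have := inf_lbound infS.2 SF; rewrite leNgt ltrBlDr ltrDl invr_gt0 ltr0n//.
exists ((\bigcup_n (~` F (inf S + n.+1%:R^-1))) `|` ((\bigcup_n F (inf S - n.+1%:R^-1)) `|` Z)).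
split.
- apply: measurableU; first by apply: bigcup_measurable => n _; exact: mFC.
  by apply: measurableU => //; apply: bigcup_measurable => n _; exact: mF.
- apply/negligibleP.
    apply: measurableU; first by apply: bigcup_measurable => n _; exact: mFC.
    by apply: measurableU => //; apply: bigcup_measurable => n _; exact: mF.
  apply: negligibleU; last apply: negligibleU.
  + by apply: negligible_bigcup => n; exact: (@negligibleP _ _ _ mu _ (mFC _)).2 (up n).
  + by apply: negligible_bigcup => n; exact: (@negligibleP _ _ _ mu _ (mF _)).2 (down n).
  + exact/negligibleP.
- move=> x /= fx; apply: contrapT => /not_orP[h1 /not_orP[h2 Zx]]; apply: fx.
  apply/eqP; rewrite eq_le; apply/andP; split.
    apply/lee_addgt0Pr => e e0.
    have [n ne] : exists n : nat, n.+1%:R^-1 <= e.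
      exists (Num.truncn e^-1); rewrite invf_ple ?posrE//; exact/ltW/truncnS_gt.
    have [fx _] : F (inf S + n.+1%:R^-1) x by apply: contrapT => h; apply: h1; exists n.
    by apply: le_trans fx _; rewrite -EFinD lee_fin lerD2l.
  apply/lee_subgt0Pr => e e0.
  have [n ne] : exists n : nat, n.+1%:R^-1 <= e.
    exists (Num.truncn e^-1); rewrite invf_ple ?posrE//; exact/ltW/truncnS_gt.
  rewrite leNgt; apply/negP => fx; apply: h2; exists n => //; split => //=.
  by apply: le_trans (ltW fx) _; rewrite -EFinB lee_fin lerB.
Qed.

End AlmostSurelyConstant.

(** * The almost sure exponent *)

Section Measurability.
Variable R : realType.

Lemma measurable_cmod_trig_poly (Q : nat) (c : nat -> R[i]) :
  measurable_fun [set: R] (fun x : R => cmod (trig_poly Q c x)).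
Proof.
have mlin (a : R) : measurable_fun [set: R] (fun x : R => 2 * pi * (a * x)).
  by apply: measurable_funM => //; apply: measurable_funM.
have mcos (a : R) : measurable_fun [set: R] (fun x : R => cos (2 * pi * (a * x))).
  apply: (measurableT_comp _ (mlin a)).
  by apply: continuous_measurable_fun; exact: continuous_cos.
have msin (a : R) : measurable_fun [set: R] (fun x : R => sin (2 * pi * (a * x))).
  apply: (measurableT_comp _ (mlin a)).
  by apply: continuous_measurable_fun; exact: continuous_sin.
have ReD (z w : R[i]) : complex.Re (z + w) = complex.Re z + complex.Re w by case: z; case: w.
have ImD (z w : R[i]) : complex.Im (z + w) = complex.Im z + complex.Im w by case: z; case: w.
have ReM (z w : R[i]) : complex.Re (z * w) =
    complex.Re z * complex.Re w - complex.Im z * complex.Im w by case: z; case: w.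
have ImM (z w : R[i]) : complex.Im (z * w) =
    complex.Re z * complex.Im w + complex.Im z * complex.Re w by case: z; case: w.
have [mRe mIm] : measurable_fun [set: R] (fun x : R => complex.Re (trig_poly Q c x)) /\
    measurable_fun [set: R] (fun x : R => complex.Im (trig_poly Q c x)).
  elim: Q => [|Q [IHr IHi]].
    have E x : trig_poly 0 c x = 0 by rewrite /trig_poly big_geq.
    by split; under eq_fun do rewrite E; exact: measurable_cst.
  have E x : trig_poly Q.+1 c x = trig_poly Q c x + c Q * expi (Q%:R * x).
    by rewrite /trig_poly big_nat_recr.
  split; under eq_fun do rewrite E ?ReD ?ImD ?ReM ?ImM /=.
  - apply: measurable_funD => //; apply: measurable_funB; apply: measurable_funM => //;
      exact: measurable_cst.
  - apply: measurable_funD => //; apply: measurable_funD; apply: measurable_funM => //;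
      exact: measurable_cst.
under eq_fun do rewrite /cmod normc_def /=.
apply: measurableT_comp; last by apply: measurable_funD; exact: measurable_funX.
by apply: continuous_measurable_fun; exact: sqrt_continuous.
Qed.

Lemma measurable_growth_rate (u : nat -> R -> R) :
  (forall n, measurable_fun [set: R] (u n)) ->
  measurable_fun [set: R] (fun x => growth_rate (fun n => u n x)).
Proof.
move=> mu; apply: measurable_fun_limn_esup => n.
have -> : (fun x => (n%:R^-1)%:E * lne (u n x)%:E)%E =
    (fun x => if u n x <= 0 then ((n%:R^-1)%:E * -oo)%E else (n%:R^-1 * ln (u n x))%:E).
  by apply/funext => x /=; case: ifP.
apply: measurable_fun_ifT => //.
- by apply: measurable_fun_ler => //; exact: measurable_cst.
- apply/measurable_EFinP; apply: measurable_funM => //.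
  by apply: measurableT_comp => //; exact: measurable_ln.
Qed.

End Measurability.

Section TwoLetterLyapunov.
Variables (R : realType) (q : nat) (zeta : substitution 2).
Hypotheses (q2 : (2 <= q)%N) (zeta_bij : bijective_subst zeta q).
Implicit Types (omega : R).
Local Notation mu := (@lebesgue_measure R).

Let q0 : (0 < q)%N. Proof. exact: ltnW. Qed.

Local Notation sgn_product := (scaled_product q (@sgn_poly R q zeta)).
Local Notation geo_product := (scaled_product q (@trig_poly R q (fun=> 1))).

Lemma sgn_productE n omega : sgn_product n omega =
  trig_poly (q ^ n) (fun j => sgn R (iter n (inflate q zeta) (fun=> ord0) j)) omega.
Proof.
have := @block_sum_scaled_product R q (col_sgn R zeta)
  (fun n j => sgn R (iter n (inflate q zeta) (fun=> ord0) j)) n omega q0.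
move=> /(_ (fun n j r => @sgn_inflate R q zeta q2 zeta_bij _ j r)).
by rewrite /= sgn0 mul1r => <-.
Qed.

Lemma geo_product_trig n omega : geo_product n omega =
  trig_poly (q ^ n) (fun=> 1) omega.
Proof.
by rewrite -geo_productE//; apply: eq_bigr => j _; rewrite mul1r.
Qed.

Lemma two_letter_size_ge0 n omega : 0 <= two_letter_size q zeta n omega.
Proof. by rewrite addr_ge0 ?cmod_ge0. Qed.

Lemma two_letter_size_le n omega : two_letter_size q zeta n omega <= 2 * q%:R ^+ n.
Proof.
have trig_le Q (c : nat -> R[i]) : (forall j, cmod (c j) <= 1) -> cmod (trig_poly Q c omega) <= Q%:R.
  move=> c1; apply: le_trans (cmod_sum_nat_le _ _ (_ : forall j, _ <= 1)) _.
    by move=> j; rewrite cmodM cmod_expi mulr1.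
  by rewrite subn0 mulr1.
rewrite /two_letter_size geo_product_trig sgn_productE mulr_natl mulr2n -natrX.
by apply: lerD; apply: trig_le => j; rewrite ?cmod1 ?cmod_sgn.
Qed.

Lemma small_divisors_all :
  {ae mu, forall omega, omega \in `[0, 1[ -> forall B, 1 < B ->
    exists2 C, 0 <= C & forall k,
    expi (q%:R ^+ k * omega) != 1 /\
    (cmod (1 - expi (q%:R ^+ k * omega)))^-1 <= C * B ^+ k}.
Proof.
have B1 n : 1 < 1 + n.+1%:R^-1 :> R by rewrite ltrDl invr_gt0.
have := ae_foralln (fun n => small_divisors q2 (B1 n)).
apply: filterS => omega h w01 B B1'.
have [n nB] : exists n : nat, n.+1%:R^-1 <= B - 1.
  exists (Num.truncn (B - 1)^-1); rewrite invf_ple ?posrE ?subr_gt0//.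
  exact/ltW/truncnS_gt.
have [C C0 hC] := h n w01; exists C => // k; have [h1 h2] := hC k; split => //.
apply: le_trans h2 _; rewrite ler_wpM2l//; apply: lerXn2r; rewrite ?nnegrE.
- by rewrite (le_trans ler01)// ltW.
- by rewrite (le_trans ler01)// ltW.
- by rewrite addrC -lerBrDr.
Qed.

(** The geometric sum of length q^n is (1 - e(q^n omega)) / (1 - e(omega)), so it
    cannot decay exponentially when the small divisors do not.  With a rate c < 0,
    comparing with B = exp(-c / 4) would bound exp(-c n / 4). *)
Lemma two_letter_growth_ge0 omega :
  (forall B, 1 < B -> exists2 C, 0 <= C & forall k,
    expi (q%:R ^+ k * omega) != 1 /\
    (cmod (1 - expi (q%:R ^+ k * omega)))^-1 <= C * B ^+ k) ->
  (0 <= growth_rate (fun n => two_letter_size q zeta n omega))%E.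
Proof.
move=> sd; rewrite leNgt; apply/negP => g0.
have [c c0 gc] : exists2 c : R, c < 0 &
    (growth_rate (fun n => two_letter_size q zeta n omega) <= c%:E)%E.
  case: growth_rate g0 => [c| |]//= c0; first by exists c; rewrite ?lte_fin in c0 *.
  by exists (-1) => //; rewrite leNye.
have {gc} := (growth_rate_leP c (fun n => two_letter_size_ge0 n omega)).1 gc.
move=> /(_ (expR (c / 2))) [|C C0 uC]; first by rewrite ltr_expR; lra.
have [|C' C'0 sd'] := sd (expR (- c / 4)); first by rewrite expR_gt1; lra.
have e1 : expi omega != 1 by have [] := sd' 0%N; rewrite mul1r.
have d0 : 0 < cmod (1 - expi omega).
  by rewrite lt_def cmod_ge0 cmod_eq0 subr_eq0 eq_sym e1.
have geoE n : cmod (geo_product n omega) * cmod (1 - expi omega) =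
    cmod (1 - expi (q%:R ^+ n * omega)).
  rewrite -cmodM -geo_productE//; congr cmod.
  have -> N : (\sum_(0 <= j < N) expi (j%:R * omega)) * (1 - expi omega) = 1 - expi (N%:R * omega).
    elim: N => [|N IHN]; first by rewrite big_geq// mul0r mul0r expi0 subrr.
    rewrite big_nat_recr//= mulrDl IHN -natr1 mulrDl mul1r expiD; ring.
  by rewrite natrX.
have bound n : expR (- c / 4 * n%:R) <= C * C' * cmod (1 - expi omega).
  have [en dn] := sd' n.
  have dn0 : 0 < cmod (1 - expi (q%:R ^+ n * omega)).
    by rewrite lt_def cmod_ge0 cmod_eq0 subr_eq0 eq_sym en.
  have h1 : cmod (1 - expi (q%:R ^+ n * omega)) <= C * expR (c / 2) ^+ n * cmod (1 - expi omega).
    rewrite -geoE ler_wpM2r ?(ltW d0)//; apply: le_trans (uC n).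
    by rewrite lerDl cmod_ge0.
  have h2 : 1 <= C' * expR (- c / 4) ^+ n * cmod (1 - expi (q%:R ^+ n * omega)).
    by rewrite -ler_pdivrMr// div1r.
  have : 1 <= C' * expR (- c / 4) ^+ n * (C * expR (c / 2) ^+ n * cmod (1 - expi omega)).
    apply: le_trans h2 _; rewrite ler_wpM2l// mulr_ge0// exprn_ge0// expR_ge0.
  have -> : C' * expR (- c / 4) ^+ n * (C * expR (c / 2) ^+ n * cmod (1 - expi omega)) =
     (C * C' * cmod (1 - expi omega)) * (expR (- c / 4) ^+ n * expR (c / 2) ^+ n) by ring.
  rewrite -exprMn -expRD -expRM_natr -ler_pdivrMr ?expR_gt0// -expRN mul1r.
  by congr (expR _ <= _); field.
have c4 : 0 < - c / 4 by lra.
pose K := C * C' * cmod (1 - expi omega).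
have := bound (Num.truncn (K / (- c / 4))).+1; apply/negP; rewrite -ltNge.
apply: lt_le_trans (expR_ge1Dx _); apply: (@lt_trans _ _ (- c / 4 * (Num.truncn (K / (- c / 4))).+1%:R)).
  by rewrite -/K [ltRHS]mulrC -ltr_pdivrMr// truncnS_gt.
by rewrite ltrDr.
Qed.

Definition exceptional_set : set R :=
  exceptional q (fun=> 1) `|` exceptional q (col_sgn R zeta).

Lemma exceptional_set_countable : countable exceptional_set.
Proof.
rewrite /exceptional_set -bigcup2E; apply: bigcup_countable; first exact: countableP.
move=> [|[|n]] _ /=; last exact: countable0.
- by apply: exceptional_countable => //; exact: oner_neq0.
- by apply: exceptional_countable => //; rewrite -cmod_eq0 cmod_sgn oner_neq0.
Qed.

(** Multiplication by q^k turns the translation by q^(-k) into a translation by 1,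
    so only the first k factors of the products change. *)
Lemma two_letter_growth_translate k omega : ~ exceptional_set omega ->
  growth_rate (fun n => two_letter_size q zeta n (omega + (q%:R ^+ k)^-1)) =
  growth_rate (fun n => two_letter_size q zeta n omega).
Proof.
move=> we; set t := (_)^-1.
have wte : ~ exceptional_set (omega + t).
  by move=> -[] /(exceptional_translate _ _ _ q0) h; apply: we; [left|right].
have neq0 x n : ~ exceptional_set x -> geo_product n x != 0 /\ sgn_product n x != 0.
  move=> xe; split; apply: scaled_product_neq0; apply: exceptionalN => h; apply: xe.
  - by left.
  - by right.
have tE : q%:R ^+ k * (omega + t) = q%:R ^+ k * omega + 1%:R.
  by rewrite mulrDr mulfV// expf_neq0// pnatr_eq0 -lt0n.
have le_w x y : ~ exceptional_set y ->
    (forall c n, scaled_product q (trig_poly q c) n (q%:R ^+ k * x) =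
       scaled_product q (trig_poly q c) n (q%:R ^+ k * y)) ->
    (growth_rate (fun n => two_letter_size q zeta n x) <=
     growth_rate (fun n => two_letter_size q zeta n y))%E.
  move=> ye xy; apply: growth_rate_le.
  - by move=> n; exact: two_letter_size_ge0.
  - by move=> n; exact: two_letter_size_ge0.
  have [K1 h1] := scaled_product_compare (fun n => (neq0 y n ye).1) (xy (fun=> 1)).
  have [K2 h2] := scaled_product_compare (fun n => (neq0 y n ye).2) (xy _).
  exists (`|K1| + `|K2|) => n; rewrite /two_letter_size mulrDr; apply: lerD.
    apply: le_trans (h1 n) _; rewrite ler_wpM2r ?cmod_ge0//.
    by rewrite (le_trans (ler_norm _))// lerDl.
  apply: le_trans (h2 n) _; rewrite ler_wpM2r ?cmod_ge0//.
  by rewrite (le_trans (ler_norm _))// lerDr.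
have period c n : scaled_product q (trig_poly q c) n (q%:R ^+ k * (omega + t)) =
    scaled_product q (trig_poly q c) n (q%:R ^+ k * omega).
  by rewrite tE scaled_product_period.
by apply/eqP; rewrite eq_le !le_w.
Qed.

Lemma two_letter_ae_growth : exists2 chi : R, 0 <= chi &
  {ae mu, forall omega, lyapunov zeta omega = chi%:E}.
Proof.
pose L omega := growth_rate (fun n => two_letter_size q zeta n omega).
have [||||||chi chi0 chiE] := @ae_constant R q L exceptional_set (ln q%:R) q2.
- apply: measurable_growth_rate => n; apply: measurable_funD.
    under eq_fun do rewrite geo_product_trig.
    exact: measurable_cmod_trig_poly.
  under eq_fun do rewrite sgn_productE.
  exact: measurable_cmod_trig_poly.
- exact: exceptional_set_countable.
- move=> k x; rewrite /exceptional_set /=.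
  by rewrite !(exceptional_translate _ _ _ q0).
- by move=> k x; exact: two_letter_growth_translate.
- move=> x; apply/growth_rate_leP => [n|B]; first exact: two_letter_size_ge0.
  rewrite lnK ?posrE ?ltr0n// => qB; exists 2 => // n.
  apply: le_trans (two_letter_size_le n x) _; rewrite ler_wpM2l//.
  by apply: lerXn2r; rewrite ?nnegrE ?ler0n// ?ltW// (le_lt_trans _ qB).
- have aeF := ae_filter_ringOfSetsType mu.
  apply: filterS small_divisors_all => omega h w01.
  by apply: two_letter_growth_ge0; exact: h.
exists chi => //; have aeF := ae_filter_ringOfSetsType mu; apply: filterS chiE => omega.
by rewrite /L -lyapunov_two_letter.
Qed.

(** The chosen constant agrees with chi because the unit interval is not null. *)
Lemma lyapunov_const_ae : exists2 chi : R, 0 <= chi &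
  lyapunov_const R zeta = chi%:E /\
  {ae mu, forall omega, lyapunov zeta omega = chi%:E}.
Proof.
have aeF := ae_filter_ringOfSetsType mu.
have [chi chi0 chiE] := two_letter_ae_growth; exists chi => //; split => //.
have ex : exists c : \bar R, ae_lyapunov_eq zeta c.
  by exists chi%:E; apply: filterS chiE => omega + _.
have constE : ae_lyapunov_eq zeta (lyapunov_const R zeta) := getPex ex.
have [N [mN N0 NE]] : \forall omega \ae mu, omega \in `[0, 1[ -> lyapunov_const R zeta = chi%:E.
  apply: filterS2 constE chiE => omega h1 h2 w01.
  by rewrite -h2 h1.
apply: contrapT => h.
have : (mu `[0%R, 1%R[%classic <= mu N)%E.
  apply: le_measure; rewrite ?inE//.
  by move=> omega w01; apply: NE => /= h'; apply: h; exact: h'.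
by rewrite N0 lebesgue_measure_itv /= lte_fin ltr01 oppr0 adde0 lee_fin ler10.
Qed.

Lemma ae_tame (chi : R) : 0 <= chi ->
  {ae mu, forall omega, lyapunov zeta omega = chi%:E} ->
  {ae mu, forall omega, omega \in `[0, 1[ ->
    forall B, expR chi < B -> tame q zeta omega B}.
Proof.
move=> chi0 chiE.
have Z0 : \forall omega \ae mu, ~ exceptional_set omega.
  exists exceptional_set; split.
  - by apply: countable_measurable => //; exact: exceptional_set_countable.
  - by apply: countable_lebesgue_measure0; exact: exceptional_set_countable.
  - by move=> omega /= /contrapT.
have aeF := ae_filter_ringOfSetsType mu.
apply: filterS3 chiE Z0 small_divisors_all => omega lE wZ sd w01 B chiB.
have B1 : 1 < B by apply: le_lt_trans chiB; rewrite -{1}expR0 ler_expR.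
have B0 : 0 < B by apply: lt_trans B1.
have [C1 C10 h1] := sd w01 B B1.
have [C2 C20 h2] : exists2 C, 0 < C & forall n, two_letter_size q zeta n omega <= C * B ^+ n.
  apply: (growth_rate_leP chi _).1 => // [n|]; first exact: two_letter_size_ge0.
  by rewrite -lyapunov_two_letter// lE.
exists (C1 + C2); first by rewrite addr_ge0// ltW.
move=> k; have [h3 h4] := h1 k; split => //.
- by apply: scaled_product_neq0; apply: exceptionalN => h; apply: wZ; right.
- apply: le_trans (_ : C2 * B ^+ k <= _); last first.
    by rewrite ler_wpM2r ?exprn_ge0 ?(ltW B0)// lerDr.
  by apply: le_trans (h2 k); rewrite lerDr cmod_ge0.
- by apply: le_trans h4 _; rewrite ler_wpM2r ?exprn_ge0 ?(ltW B0)// lerDl ltW.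
Qed.

End TwoLetterLyapunov.

(** * Factors of the subshift *)

Section FactorGrowth.
Variables (R : realType) (q : nat) (zeta : substitution 2).
Hypotheses (q2 : (2 <= q)%N) (zeta_bij : bijective_subst zeta q).
Variables (m : nat) (sigma : substitution m).
Hypotheses (m2 : (2 <= m)%N) (sigma_prim : primitive sigma).
Hypothesis sigma_factor : topological_factor (subshift zeta) (subshift sigma).
Implicit Types (omega B : R).

Let q0 : (0 < q)%N. Proof. exact: ltnW. Qed.
Let zeta_q : constant_length zeta q. Proof. exact: zeta_bij.1. Qed.

(** The word sigma^n(a) occurs in a point of X_sigma, hence is the image by the
    block code of a slightly longer word of X_zeta, and the latter occurs in some
    zeta^N(a'). *)
Lemma factor_word_code : exists k (g : seq 'I_2 -> 'I_m), forall n a,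
  exists (A N : nat) (z : nat -> 'I_2),
    (size (subst_iter sigma n [:: a]) <= q ^ N)%N /\
    forall j, (j < size (subst_iter sigma n [:: a]))%N ->
      nth a (subst_iter sigma n [:: a]) j =
      g (mkseq (fun t => iter N (inflate q zeta) z (A + j + t)%N) k).
Proof.
have Y0 : subshift sigma !=set0.
  have [y Xy _] := subst_iter_in_subshift m2 sigma_prim 0 (Ordinal (ltnW m2)).
  by exists y.
have [r [g gP]] := topological_factor_block_code Y0 sigma_factor.
exists (r + r).+1, g => n a.
have [y Xy [i yi]] := subst_iter_in_subshift m2 sigma_prim n a.
have [x Xx yx] := gP y Xy.
set w := subst_iter sigma n [:: a] in yi *.
have [a' [N]] := Xx (i - r%:Z) (size w + (r + r))%N.
rewrite -/(subst_iter zeta N [:: a']) => /infixP[p [s E]].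
have sz := congr1 size E; rewrite !size_cat size_mkseq (size_subst_iter_const zeta_q) muln1 in sz.
exists (size p), N, (fun=> a'); split; first by lia.
move=> j jw; rewrite -yi// yx; congr g; apply: (@eq_from_nth _ ord0); rewrite !size_mkseq// => t tr.
rewrite !nth_mkseq//.
have jt : (size p + j + t < q ^ N)%N by lia.
have := iter_inflate q0 zeta_q (fun=> a') 0 jt; rewrite muln0 add0n => ->.
rewrite E nth_cat ifF; last by rewrite -addnA ltnNge leq_addr.
rewrite -addnA addKn.
rewrite nth_cat size_mkseq ifT; last by lia.
rewrite nth_mkseq; last by lia.
by congr x; lia.
Qed.

Lemma factor_letter_sum_le omega B : 1 < B -> tame q zeta omega B ->
  exists2 K, 0 <= K & forall n a b N,
    (size (subst_iter sigma n [:: a]) <= q ^ N)%N ->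
    cmod (letter_sum (subst_iter sigma n [:: a]) b omega) <= K * B ^+ N.
Proof.
move=> B1 tame_w; have B0 : 0 < B by apply: lt_trans B1.
have [k [g gP]] := factor_word_code.
pose G b (w : seq 'I_2) : R[i] := (g w == b)%:R.
have G1 b w : cmod (G b w) <= 1 by rewrite /G cmod_nat lern1 leq_b1.
have [K KP] := choice (fun b => code_sum_le q2 zeta_bij k B1 tame_w (G1 b)).
exists (\sum_b `|K b|); first by apply: sumr_ge0.
move=> n a b N wN; have [A [N' [z [wN' wE]]]] := gP n a.
set w := subst_iter sigma n [:: a] in wN wN' wE *.
have Kb : K b <= \sum_c `|K c|.
  rewrite (bigD1 b)//=; apply: le_trans (ler_norm _) _; rewrite lerDl.
  by apply: sumr_ge0.
have -> : cmod (letter_sum w b omega) = cmod (\sum_(A <= j < A + size w)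
    G b (mkseq (fun t => iter N' (inflate q zeta) z (j + t)%N) k) * expi (j%:R * omega)).
  rewrite -[LHS]mul1r -{1}(cmod_expi (A%:R * omega)) -cmodM mulr_sumr; congr cmod.
  rewrite -{2}[A]add0n big_addn addKn; apply: eq_big_nat => j /andP[_ jw].
  rewrite (set_nth_default a)// wE// [(j + A)%N]addnC natrD mulrDl expiD /G; ring.
(* If the ambient word has fewer than N levels, its own level count is used. *)
have [NN'|N'N] := leqP N N'.
  rewrite -(subnKC NN'); under eq_bigr => j _ do under eq_mkseq => t do rewrite iterD.
  apply: le_trans (KP b N _ _ _ wN) _.
  by rewrite ler_wpM2r ?exprn_ge0 ?(ltW B0).
apply: le_trans (KP b N' _ _ _ wN') _.
apply: le_trans (_ : (\sum_c `|K c|) * B ^+ N' <= _).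
  by rewrite ler_wpM2r ?exprn_ge0 ?(ltW B0).
by rewrite ler_wpM2l ?sumr_ge0// ler_weXn2l ?(ltW B1)// ltnW.
Qed.

(** With N the least integer above log_q ((C + 1) r^n), the sums over sigma^n(a) are O(B^N),
    and B^N is of the order of exp (n ln B ln r / ln q). *)
Lemma factor_lyapunov_le omega B r : 1 < B -> tame q zeta omega B ->
  spectral_radius R (subst_mx sigma) < r ->
  (lyapunov sigma omega <= (ln B / ln q%:R * ln r)%:E)%E.
Proof.
move=> B1 tame_w rho_r; have B0 : 0 < B by apply: lt_trans B1.
have r1 : 1 < r by apply: lt_trans rho_r; exact: spectral_radius_gt1.
have r0 : 0 < r by apply: lt_trans r1.
have lnq : 0 < ln q%:R :> R by rewrite ln_gt0// ltr1n.
have lnB : 0 < ln B by rewrite ln_gt0.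
have [K K0 KP] := factor_letter_sum_le B1 tame_w.
have [C C0 CP] := size_subst_iter_le rho_r.
pose beta := ln B / ln q%:R.
have beta0 : 0 < beta by rewrite divr_gt0.
pose u n := complex.Re (mx_norm (spectral_cocycle sigma (const_mx omega : 'cV[R]_m) n)).
rewrite -[lyapunov _ _]/(growth_rate u).
apply/growth_rate_leP => [n|D betaD]; first by rewrite /u Re_mx_norm_ge0.
exists ((K + 1) * (B * expR (beta * ln (C + 1)))).
  by rewrite mulr_gt0 ?ltr_wpDl// mulr_gt0// expR_gt0.
move=> n.
pose l := (ln (C + 1) + n%:R * ln r) / ln q%:R.
have lnC : 0 <= ln (C + 1) by rewrite ln_ge0// lerDr ltW.
have l0 : 0 <= l.
  by rewrite divr_ge0 ?(ltW lnq)// addr_ge0// mulr_ge0// ln_ge0// ltW.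
pose N := (Num.truncn l).+1.
have lN : l <= N%:R by exact/ltW/truncnS_gt.
have Nl : N%:R <= l + 1.
  by rewrite -natr1 lerD2r; have /andP[] := truncn_itv l0.
have qN a : (size (subst_iter sigma n [:: a]) <= q ^ N)%N.
  rewrite -(ler_nat R); apply: le_trans (CP n a) _.
  apply: le_trans (_ : (C + 1) * r ^+ n <= _).
    by rewrite ler_wpM2r ?exprn_ge0 ?(ltW r0)// lerDl.
  rewrite natrX -[q%:R](@lnK R) ?posrE ?ltr0n// -expRM_natl.
  rewrite -[C + 1](@lnK R) ?posrE ?addr_gt0// -{1}[r](@lnK R) ?posrE// -expRM_natl -expRD.
  by rewrite ler_expR -ler_pdivrMr.
apply: le_trans (_ : K * B ^+ N <= _).
  apply: mx_norm_le => [|a b]; first by rewrite mulr_ge0// exprn_ge0// ltW.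
  by rewrite spectral_cocycleE; exact: KP.
rewrite -[leRHS]mulrA; apply: ler_pM => //; first by rewrite exprn_ge0// ltW.
  by rewrite lerDl.
apply: le_trans (_ : expR (ln B * (l + 1)) <= _).
  by rewrite -{1}[B](@lnK R) ?posrE// -expRM_natl ler_expR mulrC ler_wpM2l// ltW.
have -> : expR (ln B * (l + 1)) = B * (expR (beta * ln (C + 1)) * expR (beta * ln r) ^+ n).
  rewrite -{2}[B](@lnK R) ?posrE// -expRM_natl -!expRD; congr expR.
  by rewrite /l /beta; field; rewrite gt_eqF.
rewrite -[leRHS]mulrA ler_wpM2l ?(ltW B0)// ler_wpM2l ?expR_ge0//.
by apply: lerXn2r; rewrite ?nnegrE ?expR_ge0// ltW// (lt_trans _ betaD)// expR_gt0.
Qed.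

End FactorGrowth.

Theorem theorem1p2 (R : realType)
    (q : nat) (hq : (2 <= q)%N)
    (zeta : substitution 2)
    (zeta_aper : aperiodic zeta) (zeta_prim : primitive zeta)
    (zeta_bij : bijective_subst zeta q)
    (m : nat) (hm : (2 <= m)%N)
    (sigma : substitution m)
    (sigma_prim : primitive sigma) (sigma_aper : aperiodic sigma)
    (sigma_factor : topological_factor (subshift zeta) (subshift sigma)) :
  {ae (@lebesgue_measure R), forall omega : R, omega \in `[0, 1[ ->
    (lyapunov sigma omega / (ln (spectral_radius R (subst_mx sigma)))%:E
     <= lyapunov_const R zeta / (ln q%:R)%:E)%E}.
Proof.
have [chi chi0 [constE chiE]] := lyapunov_const_ae R hq zeta_bij.
have aeF := ae_filter_ringOfSetsType (@lebesgue_measure R).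
apply: filterS (ae_tame hq zeta_bij chi0 chiE) => omega tame_w w01.
set rho := spectral_radius R _.
have rho1 : 1 < rho by exact: spectral_radius_gt1.
have rho0 : 0 < rho by apply: lt_trans rho1.
have lnrho : 0 < ln rho by rewrite ln_gt0.
have lnq : 0 < ln q%:R :> R by rewrite ln_gt0// ltr1n.
rewrite constE !inver !gt_eqF//.
have le_e e : 0 < e -> (lyapunov sigma omega <= ((chi + e) / ln q%:R * (ln rho + e))%:E)%E.
  move=> e0; have := @factor_lyapunov_le R q zeta hq zeta_bij m sigma hm sigma_prim sigma_factor
    omega (expR (chi + e)) (rho * expR e).
  rewrite expRK lnM ?posrE ?expR_gt0// expRK; apply.
  - by rewrite expR_gt1 ltr_wpDl.
  - by apply: tame_w => //; rewrite ltr_expR ltrDl.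
  - by rewrite ltr_pMr// expR_gt1.
(* Let e tend to 0; d is chosen so that d (chi + ln rho + 1) <= e ln q and d <= 1. *)
have le_lim : (lyapunov sigma omega <= (chi / ln q%:R * ln rho)%:E)%E.
  apply/lee_addgt0Pr => e e0.
  have s0 : 0 < chi + ln rho + 1 by rewrite addr_gt0// ltr_wpDl.
  pose d := Num.min 1 (e * ln q%:R / (chi + ln rho + 1)).
  have d0 : 0 < d by rewrite lt_min ltr01 divr_gt0// mulr_gt0.
  have d1 : d <= 1 by rewrite ge_min lexx.
  have d2 : d * (chi + ln rho + 1) <= e * ln q%:R.
    by rewrite -ler_pdivlMr// ge_min lexx orbT.
  apply: le_trans (le_e d d0) _; rewrite -EFinD lee_fin.
  have -> : chi / ln q%:R * ln rho + e = (chi * ln rho + e * ln q%:R) / ln q%:R.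
    by field; rewrite gt_eqF.
  rewrite mulrAC ler_wpM2r ?invr_ge0 ?(ltW lnq)//.
  have : d * d <= d * 1 by rewrite ler_wpM2l// ltW.
  lra.
apply: le_trans (lee_wpmul2r _ le_lim) _; first by rewrite lee_fin invr_ge0 ltW.
rewrite -!EFinM lee_fin mulfK// gt_eqF//.
Qed.
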